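(* Let $F|K$ be an algebraic function field. The discrete zero-dimensional places $P\in S(F|K)$ with residue field $FP$ a finite extension of $K$ lie dense in $S(F|K)$ with respect to the patch topology.
   Context: An algebraic function field $F|K$ is a finitely generated field extension of transcendence degree at least $1$; the characteristic is arbitrary. $S(F|K)$ is the set of all places $P$ of $F$ whose restriction to $K$ is the identity, up to equivalence. $\mathcal O_P$ is the valuation ring of $P$, $\mathcal M_P$ its maximal ideal, $FP$ its residue field, $v_PF$ its value group. $P$ is zero-dimensional if $\operatorname{trdeg}(FP|K)=0$, and discrete if $v_PF\cong\mathbb Z$. The patch topology on $S(F|K)$ has as basic open sets the sets $\{P\in S(F|K)\mid a_1,\ldots,a_k\in\mathcal O_P;\ b_1,\ldots,b_\ell\in\mathcal M_P\}$ with $k,\ell\ge0$ and $a_i,b_j\in F$. *)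

(* Defs.v *)
From HB Require Import structures.
From mathcomp Require Import all_boot all_order all_algebra.
From mathcomp Require Import boolp classical_sets topology.
(* The notations of mpoly clash with those of topology. *)
From mathcomp Require Import (canonicals, coercions) mpoly.

Set Implicit Arguments.
Unset Strict Implicit.
Unset Printing Implicit Defensive.

Import Order.TTheory GRing.Theory Num.Theory.
Local Open Scope classical_set_scope.
Local Open Scope ring_scope.

(* A field extension E|K is a ring morphism iota : K -> E. *)
Section Extensions.
Variables (K E : fieldType) (iota : {rmorphism K -> E}).

Definition alg_independent n (t : 'I_n -> E) :=
  forall p : mpoly.mpoly n K, mpoly.mmap iota t p = 0 -> p = 0.

Definition trdeg_ge n := exists t : 'I_n -> E, alg_independent t.

Definition trdeg_eq n := trdeg_ge n /\ ~ trdeg_ge n.+1.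

(* [GRing.divring_closed S] says that S is a subfield of E (x / 0 is 0). *)
Definition finitely_generated := exists s : seq E,
  forall S : {pred E}, GRing.divring_closed S ->
    (forall c, iota c \in S) -> {subset s <= S} -> forall x, x \in S.

Definition function_field := finitely_generated /\ trdeg_ge 1.

Definition finite_extension := exists (n : nat) (e : 'I_n -> E),
  forall y, exists c : 'I_n -> K, y = \sum_(i < n) iota (c i) * e i.

End Extensions.

Section Places.
Variables (K F : fieldType) (iota : {rmorphism K -> F}).

(* A place P of F with residue field FP; the value None stands for infinity.
   The residue field is an extension of K through [residue_emb], and
   [place_id] says that the restriction of P to K is the identity. *)
Record place := Place {
  residue : fieldType;
  residue_emb : {rmorphism K -> residue};
  place_val :> F -> option residue;
  place_id : forall c, place_val (iota c) = Some (residue_emb c);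
  place_add : forall x y a b, place_val x = Some a -> place_val y = Some b ->
    place_val (x + y) = Some (a + b);
  place_mul : forall x y a b, place_val x = Some a -> place_val y = Some b ->
    place_val (x * y) = Some (a * b);
  place_inv : forall x, place_val x = None -> place_val x^-1 = Some 0;
  place_surj : forall a, exists x, place_val x = Some a }.

Definition val_ring (P : place) : set F := [set x | P x <> None].
Definition max_ideal (P : place) : set F := [set x | P x = Some 0].

Definition place_equiv (P Q : place) := val_ring P = val_ring Q.

(* S(F|K), the set of places up to [place_equiv]. As [place] is too large to be
   a choiceType, a class of equivalent places is encoded by the valuation ring
   common to its members. *)
Record place_space := PlaceSpace {
  class_ring : set F;
  class_ring_place : exists P : place, class_ring = val_ring P }.

HB.instance Definition _ := gen_eqMixin place_space.
HB.instance Definition _ := gen_choiceMixin place_space.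

Definition class_of (P : place) : place_space :=
  PlaceSpace (ex_intro _ P erefl).

Lemma class_of_surj p : exists P, class_of P = p.
Proof.
case: p => O [P OP]; exists P; move: (ex_intro _ _ _); rewrite OP => ?.
by congr PlaceSpace; exact: Prop_irrelevance.
Qed.

Lemma class_of_eq P Q : class_of P = class_of Q <-> place_equiv P Q.
Proof.
split=> [[]//|]; rewrite /class_of; move: (ex_intro _ _ _) (ex_intro _ _ _).
by rewrite /place_equiv => + + PQ; rewrite PQ => *;
  congr PlaceSpace; exact: Prop_irrelevance.
Qed.

(* v is a valuation associated with P (its value at 0 is irrelevant) with value
   group int: it induces an isomorphism of ordered groups from
   v_P F = F^* / O_P^*, whose nonnegative elements are the classes of the
   nonzero elements of O_P, onto int. *)
Definition discrete_valuation_of (P : place) (v : F -> int) :=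
  [/\ forall x y, x != 0 -> y != 0 -> v (x * y) = v x + v y,
      forall n, exists2 x, x != 0 & v x = n &
      forall x, x != 0 -> (val_ring P x <-> 0 <= v x)].

Definition discrete_place (P : place) := exists v, discrete_valuation_of P v.

Definition zero_dimensional_place (P : place) := trdeg_eq (residue_emb P) 0.

(* A set of equivalence classes; the conditions only depend on the class of P,
   see [patch_basic_class]. *)
Definition patch_basic (ab : seq F * seq F) : set place_space :=
  [set p | exists P, [/\ class_of P = p,
     forall a, a \in ab.1 -> val_ring P a &
     forall b, b \in ab.2 -> max_ideal P b]].

Lemma place1 (P : place) : P 1 = Some 1.
Proof. by rewrite -(rmorph1 iota) place_id rmorph1. Qed.

Lemma max_idealE (P : place) x :
  max_ideal P x <-> x = 0 \/ ~ val_ring P x^-1.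
Proof.
have P0 : P 0 = Some 0 by rewrite -(rmorph0 iota) place_id rmorph0.
split=> [Px|[->//|]]; last first.
  by move=> /contrapT /place_inv; rewrite invrK.
have [->|x0] := eqVneq x 0; [by left|right; apply].
case Pxi : (P x^-1) => [a|//].
have := place_mul Px Pxi; rewrite divff// place1 mul0r => -[] /eqP.
by rewrite oner_eq0.
Qed.

Lemma patch_basic_class ab P :
  patch_basic ab (class_of P) <->
  (forall a, a \in ab.1 -> val_ring P a) /\
  (forall b, b \in ab.2 -> max_ideal P b).
Proof.
split=> [[Q [/class_of_eq QP Qa Qb]]|[Pa Pb]]; last by exists P.
split=> [a /Qa|b /Qb]; first by rewrite QP.
by rewrite !max_idealE QP.
Qed.

Lemma patch_cover : \bigcup_(ab in [set: seq F * seq F]) patch_basic ab = setT.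
Proof.
rewrite -subTset => p _; exists ([::], [::]) => //.
by have [P <-] := class_of_surj p; apply/patch_basic_class.
Qed.

Lemma patch_join (i j : seq F * seq F) (p : place_space) :
  [set: seq F * seq F] i -> [set: seq F * seq F] j ->
  patch_basic i p -> patch_basic j p ->
  exists k, [/\ [set: seq F * seq F] k, patch_basic k p &
                patch_basic k `<=` patch_basic i `&` patch_basic j].
Proof.
move=> _ _; have [P <-] := class_of_surj p.
move=> /patch_basic_class[ia ib] /patch_basic_class[ja jb].
exists (i.1 ++ j.1, i.2 ++ j.2); split=> //.
  by apply/patch_basic_class; split=> x; rewrite /= mem_cat => /orP[]; auto.
move=> q; have [Q <-] := class_of_surj q => /patch_basic_class[/= Qa Qb].
split; apply/patch_basic_class; split=> x xi;
  by [apply: Qa; rewrite mem_cat xi ?orbT | apply: Qb; rewrite mem_cat xi ?orbT].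
Qed.

End Places.

Section PatchTopology.
Variables (K F : fieldType) (iota : {rmorphism K -> F}).

HB.instance Definition _ := isPointed.Build (seq F) [::].

HB.instance Definition _ := isBaseTopological.Build (place_space iota)
  (patch_cover iota) (@patch_join K F iota).

End PatchTopology.

(* Main.v *)
Require Import Defs.
From HB Require Import structures.
From mathcomp Require Import all_boot all_order all_algebra.
From mathcomp Require Import generic_quotient ring_quotient ring zify.
From mathcomp Require Import boolp classical_sets topology.
From mathcomp Require Import (canonicals, coercions) mpoly.

(** Let P be a place of F|K, and let A and B be finite subsets of its valuation
    ring and of its maximal ideal. A discrete place Q with residue field finite
    over K has to be found for which A and B satisfy the same conditions.

    Enlarge A by B and by a generator of F, or its inverse, for each of finitely
    many generators of F; then F is the fraction field of K[A]. By
    [algebraic_specialization] the elements of A may be assumed to have residues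
    at P which are algebraic over K. By [noether_normalization] there is a
    polynomial ring R = K[y_1, ..., y_n] inside K[A] over which A is integral.
    Let k be the residue field of P and y0 the residue of y, a point with
    coordinates in a finite extension of K.

    The map sending y_i to y0_i plus a suitable lacunary power series without
    constant term is an injective morphism from R to k[[t]]
    ([arc_coef_neq0]). It induces on the fraction field of R a discrete valuation
    ring W with residue field finite over K and the same center on R as P. Every
    valuation ring Q of F which dominates W contains A, because A is integral
    over R. It is discrete and its residue field is finite over K, because F is
    finite over the fraction field of R ([discrete_dominating],
    [residue_finite]).

    Such a Q may have another center on K[A] than P, so that the elements of B
    may be units at Q. But there is an element w of F, integral over R and a unit
    at P, such that B is in the maximal ideal of every Q above the center of P at
    which w is a unit ([separating_element]). As R is normal, some Q dominating W
    has this property ([going_down]).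

    Valuation rings are obtained from Chevalley's theorem ([chevalley]). *)

Set Implicit Arguments.
Unset Strict Implicit.
Unset Printing Implicit Defensive.

Import Order.TTheory GRing.Theory Num.Theory.
Local Open Scope classical_set_scope.
Local Open Scope ring_scope.

(** * Existence of valuation rings *)

Notation coefs_in B p := (forall i, B p%R`_i).

Section ValuationRings.
Variable F : fieldType.
Implicit Types (B J O : set F) (p q : {poly F}) (x y u : F).

Definition subring B :=
  [/\ B 1, forall x y, B x -> B y -> B (x - y)
    & forall x y, B x -> B y -> B (x * y)].

Definition ideal B J :=
  [/\ J `<=` B, J 0, forall x y, J x -> J y -> J (x + y)
    & forall x y, B x -> J y -> J (x * y)].

Definition valring O := subring O /\ forall x, O x \/ O x^-1.

(** For a valuation ring O this is its maximal ideal, in the form in which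
    [max_idealE] describes that of a place. *)
Definition nonunit O : set F := [set x | x = 0 \/ ~ O x^-1].

Lemma subring0 B : subring B -> B 0.
Proof. by case=> B1 BB _; rewrite -(subrr 1); exact: BB. Qed.

Lemma subringN B x : subring B -> B x -> B (- x).
Proof.
by move=> rB Bx; rewrite -sub0r; case: (rB) => _ BB _; apply: BB => //;
  exact: subring0.
Qed.

Lemma subringD B x y : subring B -> B x -> B y -> B (x + y).
Proof.
by move=> rB Bx By; rewrite -(opprK y); case: (rB) => _ BB _; apply: BB => //;
  exact: subringN.
Qed.

Lemma subringM B x y : subring B -> B x -> B y -> B (x * y).
Proof. by case=> _ _; apply. Qed.

Lemma subringX B x n : subring B -> B x -> B (x ^+ n).
Proof.
move=> rB Bx; elim: n => [|n IH]; first by rewrite expr0; case: rB.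
by rewrite exprS; exact: subringM.
Qed.

Lemma subring_sum B I (r : seq I) (P : pred I) (f : I -> F) : subring B ->
  (forall i, P i -> B (f i)) -> B (\sum_(i <- r | P i) f i).
Proof.
move=> rB Bf; elim/big_ind: _ => //; first exact: subring0.
by move=> x y; exact: subringD.
Qed.

Lemma subring_horner B p x : subring B -> coefs_in B p -> B x -> B p.[x].
Proof.
move=> rB Bp Bx; rewrite horner_coef; apply: subring_sum => // i _.
by apply: subringM => //; exact: subringX.
Qed.

Section Ideals.
Variables B J : set F.
Hypotheses (rB : subring B) (iJ : ideal B J).

Lemma idealN x : J x -> J (- x).
Proof.
case: iJ => _ _ _ JM Jx; rewrite -mulN1r; apply: JM => //.
by apply: subringN => //; case: rB.
Qed.

Lemma ideal_sum I (r : seq I) (P : pred I) (f : I -> F) :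
  (forall i, P i -> J (f i)) -> J (\sum_(i <- r | P i) f i).
Proof. by case: iJ => _ J0 JD _ Jf; elim/big_ind: _. Qed.

Lemma ideal_horner p x : coefs_in J p -> B x -> J p.[x].
Proof.
move=> Jp Bx; rewrite horner_coef; apply: ideal_sum => i _.
by rewrite mulrC; case: iJ => _ _ _; apply => //; exact: subringX.
Qed.

Definition adjoin (S : set F) x :=
  [set y | exists2 p : {poly F}, coefs_in S p & y = p.[x]].

Lemma sub_adjoin S x : S 0 -> S `<=` adjoin S x.
Proof.
move=> S0 y Sy; exists y%:P; last by rewrite hornerC.
by move=> i; rewrite coefC; case: ifP.
Qed.

Lemma adjoin_gen x : adjoin B x x.
Proof.
exists 'X; last by rewrite hornerX.
move=> i; rewrite coefX; have B0 := subring0 rB.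
by case: (i == _) => //; case: rB.
Qed.

Lemma adjoin_subring x : subring (adjoin B x).
Proof.
case: (rB) => B1 BB BM; split=> [|_ _ [p Bp ->] [q Bq ->]|_ _ [p Bp ->] [q Bq ->]].
- by apply: sub_adjoin => //; exact: subring0.
- by exists (p - q); [move=> i; rewrite coefB; exact: BB|rewrite hornerD hornerN].
- exists (p * q); last by rewrite hornerM.
  by move=> i; rewrite coefM; apply: subring_sum => // j _; exact: BM.
Qed.

Lemma adjoin_ideal x : ideal (adjoin B x) (adjoin J x).
Proof.
case: (iJ) => JB J0 JD JM; split.
- by move=> _ [p Jp ->]; exists p => // i; exact: JB.
- exact: sub_adjoin.
- move=> _ _ [p Jp ->] [q Jq ->]; exists (p + q); last by rewrite hornerD.
  by move=> i; rewrite coefD; exact: JD.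
- move=> _ _ [p Bp ->] [q Jq ->]; exists (p * q); last by rewrite hornerM.
  by move=> i; rewrite coefM; apply: ideal_sum => j _; exact: JM.
Qed.

End Ideals.

(** Clearing the denominators of a polynomial in 1/x. *)
Lemma rev_horner p x n : x != 0 -> (size p <= n.+1)%N ->
  x ^+ n * p.[x^-1] = \sum_(i < n.+1) p`_(n - i) * x ^+ i.
Proof.
move=> x0 pn; rewrite (horner_coef_wide _ pn) mulr_sumr.
rewrite (reindex_inj rev_ord_inj); apply: eq_bigr => i _ /=.
rewrite subSS mulrCA exprVn; congr (_ * _).
apply: (canLR (mulfK _)); first by rewrite expf_neq0.
by rewrite -exprD subnKC // -ltnS.
Qed.

Definition proper_pair (B J : set F) := [/\ subring B, ideal B J & ~ J 1].

(** If neither x nor 1/x were in O, then 1 would be a value at x and a value at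
    1/x of polynomials over M; as 1 - b is invertible in O for b in M, the
    relation of smaller degree lowers the degree of the other one, and infinite
    descent leads to a contradiction. *)
Lemma maximal_pair_valring O M : proper_pair O M ->
  (forall x, ~ adjoin M x 1 -> O x) -> valring O.
Proof.
move=> [rO iM M1] max; split=> // x; apply: contrapT => /not_orP[Ox Ox'].
have [MO M0 MD MM] := iM.
have unit1B b : M b -> O (1 - b)^-1.
  move=> Mb; apply: max => -[p Mp].
  have Ou : O (1 - b) by case: (rO) => O1 OB _; apply: OB => //; exact: MO.
  have [b1|b1] := eqVneq b 1; first by rewrite b1 in Mb.
  have u0 : 1 - b != 0 by rewrite subr_eq0 eq_sym.
  move=> /(congr1 ( *%R ((1 - b) ^+ size p))); rewrite mulr1 rev_horner// => E.
  have : M ((1 - b) ^+ size p).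
    rewrite E; apply: (ideal_sum iM) => i _; rewrite mulrC.
    by apply: MM => //; exact: subringX.
  elim: (size p) => [|n IH]; first by rewrite expr0.
  move=> Mu; apply: IH.
  have -> : (1 - b) ^+ n = (1 - b) ^+ n.+1 + (1 - b) ^+ n * b.
    by rewrite exprSr mulrBr mulr1 subrK.
  by apply: MD => //; apply: MM => //; exact: subringX.
suff main n : forall y p q, y != 0 -> (size p + size q <= n)%N ->
    (size q <= size p)%N -> coefs_in M p -> coefs_in M q ->
    p.[y] = 1 -> q.[y^-1] = 1 -> False.
  have x0 : x != 0.
    by apply/negP => /eqP x0; apply: Ox; rewrite x0; exact: subring0.
  have /contrapT[p Mp /esym p1] := contra_not (max x) Ox.
  have /contrapT[q Mq /esym q1] := contra_not (max x^-1) Ox'.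
  have [pq|/ltnW pq] := leqP (size q) (size p); first exact: (main _ x p q).
  by apply: (main (size q + size p)%N x^-1 q p) => //;
    rewrite ?invr_eq0 // invrK.
(* the roles of x and 1/x are exchanged when p' becomes shorter than q *)
elim: n => [|n IH] y p q y0 spq qp Mp Mq p1 q1.
  move: spq p1; rewrite leqn0 addn_eq0 size_poly_eq0 => /andP[/eqP-> _].
  by rewrite horner0 => /eqP; rewrite eq_sym oner_eq0.
case sp : (size p) => [|d].
  move/eqP: sp p1; rewrite size_poly_eq0 => /eqP->.
  by rewrite horner0 => /eqP; rewrite eq_sym oner_eq0.
have Ou := unit1B _ (Mq 0%N).
have u0 : 1 - q`_0 != 0.
  by apply/negP; rewrite subr_eq0 => /eqP q01; apply: M1; rewrite q01.
have qd : (size q <= d.+1)%N by rewrite -sp.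
have yd : y ^+ d = (1 - q`_0)^-1 * \sum_(i < d) q`_(d - i) * y ^+ i.
  apply: (mulfI u0); rewrite mulVKf //.
  have := rev_horner y0 qd; rewrite q1 mulr1 big_ord_recr /= subnn => E.
  by rewrite mulrBl mul1r {1}E addrK.
pose p' := \poly_(i < d) (p`_i + p`_d * ((1 - q`_0)^-1 * q`_(d - i))).
have p'1 : p'.[y] = 1.
  rewrite horner_poly -[RHS]p1 (@horner_coef_wide _ d.+1) ?sp// big_ord_recr /= yd.
  rewrite !mulr_sumr -big_split /=; apply: eq_bigr => i _.
  by rewrite mulrDl !mulrA.
have Mp' : coefs_in M p'.
  move=> i; rewrite coef_poly; case: ifP => // _; apply: MD => //.
  by apply: (MM); [exact: MO|exact: MM].
have sp' : (size p' <= d)%N by exact: size_poly.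
have [qp'|/ltnW qp'] := leqP (size q) (size p').
  apply: (IH y p' q) => //; rewrite -ltnS; apply: leq_trans spq.
  by rewrite ltn_add2r sp ltnS.
apply: (IH y^-1 q p') => //; rewrite ?invr_eq0 ?invrK //.
rewrite -ltnS; apply: leq_trans spq.
by rewrite addnC ltn_add2r sp ltnS.
Qed.

(** Chevalley's extension theorem. Zorn's lemma is applied to pairs of a ring
    and a proper ideal, ordered by inclusion of both components: adjoining x to
    both components of a maximal pair makes the ideal improper unless x is
    already in the ring. *)
Theorem chevalley B J : proper_pair B J ->
  exists O, [/\ valring O, B `<=` O & J `<=` nonunit O].
Proof.
move=> pBJ.
pose T := {X : set F * set F | [/\ proper_pair X.1 X.2, B `<=` X.1 & J `<=` X.2]}.
pose R (s t : T) := `[< (sval s).1 `<=` (sval t).1 /\ (sval s).2 `<=` (sval t).2 >].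
have [||| |t max] := @Zorn T R.
- by move=> t; apply/asboolP; split=> ?.
- move=> r s t /asboolP[rs1 rs2] /asboolP[st1 st2]; apply/asboolP.
  by split=> x; [move=> /rs1; exact: st1|move=> /rs2; exact: st2].
- move=> [[s1 s2] Hs] [[t1 t2] Ht] /asboolP[/= st1 st2] /asboolP[/= ts1 ts2].
  by apply: eq_exist; congr pair; exact/seteqP.
- move=> A Atot; have [[a0 Aa0]|A0] := pselect (exists a, A a); last first.
    have H : [/\ proper_pair (B, J).1 (B, J).2, B `<=` (B, J).1 & J `<=` (B, J).2].
      by split.
    by exists (exist _ (B, J) H) => s As; exfalso; apply: A0; exists s.
  pose U1 := \bigcup_(a in A) (sval a).1; pose U2 := \bigcup_(a in A) (sval a).2.
  have common a b : A a -> A b -> exists c, [/\ A c,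
      (sval a).1 `<=` (sval c).1, (sval a).2 `<=` (sval c).2,
      (sval b).1 `<=` (sval c).1 & (sval b).2 `<=` (sval c).2].
    move=> Aa Ab; have [/asboolP[ab1 ab2]|/asboolP[ba1 ba2]] := Atot a b Aa Ab.
      by exists b; split.
    by exists a; split.
  have H : [/\ proper_pair (U1, U2).1 (U1, U2).2, B `<=` (U1, U2).1
      & J `<=` (U1, U2).2].
    split=> /=; last 2 first.
    - by move=> x Bx; exists a0 => //; case: (svalP a0) => _ /(_ _ Bx).
    - by move=> x Bx; exists a0 => //; case: (svalP a0) => _ _ /(_ _ Bx).
    split.
    - split.
      + by exists a0 => //; case: (svalP a0) => -[[]].
      + move=> x y [a Aa ax] [b Ab byy].
        have [c [Ac ac _ bc _]] := common _ _ Aa Ab; exists c => //.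
        by case: (svalP c) => -[[_ + _] _ _] _ _; apply; [exact: ac|exact: bc].
      + move=> x y [a Aa ax] [b Ab byy].
        have [c [Ac ac _ bc _]] := common _ _ Aa Ab; exists c => //.
        by case: (svalP c) => -[[_ _ +] _ _] _ _; apply; [exact: ac|exact: bc].
    - split.
      + move=> x [a Aa ax]; exists a => //.
        by case: (svalP a) => -[_ [+ _ _ _] _] _ _; apply.
      + by exists a0 => //; case: (svalP a0) => -[_ []].
      + move=> x y [a Aa ax] [b Ab byy].
        have [c [Ac _ ac _ bc]] := common _ _ Aa Ab; exists c => //.
        by case: (svalP c) => -[_ [_ _ + _] _] _ _; apply; [exact: ac|exact: bc].
      + move=> x y [a Aa ax] [b Ab byy].
        have [c [Ac ac _ _ bc]] := common _ _ Aa Ab; exists c => //.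
        by case: (svalP c) => -[_ [_ _ _ +] _] _ _; apply; [exact: ac|exact: bc].
    - by move=> [a Aa]; case: (svalP a) => -[].
  by exists (exist _ (U1, U2) H) => s As; apply/asboolP; split=> x sx; exists s.
have [pOM BO JM] := svalP t.
set O := (sval t).1 in pOM BO; set M := (sval t).2 in pOM JM.
have [rO iM M1] := pOM; have [MO M0 _ _] := iM.
have vO : valring O.
  apply: (maximal_pair_valring pOM) => x Mx.
  pose X := (adjoin O x, adjoin M x).
  have H : [/\ proper_pair X.1 X.2, B `<=` X.1 & J `<=` X.2].
    split=> /=; last 2 first.
    - by move=> y /BO Oy; apply: sub_adjoin => //; exact: subring0.
    - by move=> y /JM My; exact: sub_adjoin.
    by split=> //; [exact: adjoin_subring|exact: adjoin_ideal].
  have <- : (sval (exist _ X H : T)).1 = O.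
    rewrite (max (exist _ X H)) //.
    by apply/asboolP; split=> /=; apply: sub_adjoin => //; exact: subring0.
  exact: adjoin_gen.
exists O; split=> // x /JM Mx; have [->|x0] := eqVneq x 0; first by left.
by right=> Ox; apply: M1; rewrite -(mulVf x0); case: iM => _ _ _; apply.
Qed.

End ValuationRings.

Lemma least_nat (P : nat -> Prop) : (exists n, P n) ->
  exists2 n, P n & forall m, (m < n)%N -> ~ P m.
Proof.
move=> [n Pn].
have exP : exists n, `[< P n >] by exists n; apply/asboolP.
case: (ex_minnP exP) => m /asboolP Pm min; exists m => // k km Pk.
by have := min k; rewrite leqNgt km => /(_ (asboolT Pk)).
Qed.

(** * Gauss's lemma and integral closure *)

Section ValringTheory.
Variables (F : fieldType) (O : set F).
Hypothesis vO : valring O.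
Implicit Types (p q g : {poly F}) (x y : F).

Let rO : subring O. Proof. by case: vO. Qed.

Lemma nonunitN1 : ~ nonunit O 1.
Proof.
case=> [/eqP|]; first by rewrite oner_eq0.
by rewrite invr1; case: rO.
Qed.

Lemma nonunit_ideal : ideal O (nonunit O).
Proof.
case: (vO) => _ Oinv.
have NO : nonunit O `<=` O.
  move=> x [->|Ox]; first exact: subring0.
  by case: (Oinv x).
have NM x y : O x -> nonunit O y -> nonunit O (x * y).
  move=> Ox [->|Oy]; first by rewrite mulr0; left.
  have [->|x0] := eqVneq x 0; first by rewrite mul0r; left.
  right=> Oxy; apply: Oy.
  by rewrite -[y^-1](mulKf x0) mulrCA -invfM; exact: subringM.
split=> //; first by left.
have ND x y : y != 0 -> O (x / y) -> nonunit O y -> nonunit O (x + y).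
  move=> y0 Oxy Ny; have -> : x + y = (x / y + 1) * y.
    by rewrite mulrDl mul1r divfK.
  by apply: NM => //; apply: subringD => //; case: rO.
move=> x y Nx Ny.
have [->|x0] := eqVneq x 0; first by rewrite add0r.
have [->|y0] := eqVneq y 0; first by rewrite addr0.
have [Oxy|] := Oinv (x / y); first exact: ND.
by rewrite invf_div addrC => Oyx; exact: ND.
Qed.

Lemma nonunit_sub x : nonunit O x -> O x.
Proof. by case: nonunit_ideal => + _ _ _; apply. Qed.

Lemma nonunitM x y : O x -> nonunit O y -> nonunit O (x * y).
Proof. by case: nonunit_ideal => _ _ _; apply. Qed.

Lemma nonunitD x y : nonunit O x -> nonunit O y -> nonunit O (x + y).
Proof. by case: nonunit_ideal => _ _ + _; apply. Qed.

Lemma nonunitN x : nonunit O x -> nonunit O (- x).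
Proof. exact: idealN nonunit_ideal _. Qed.

Lemma nonunitB x y : nonunit O x -> nonunit O y -> nonunit O (x - y).
Proof. by move=> Nx /nonunitN; exact: nonunitD. Qed.

Lemma nonunit_inv x : nonunit O x -> O x^-1 -> x = 0.
Proof. by case. Qed.

Lemma unit_inv x : ~ nonunit O x -> O x^-1.
Proof. by move=> /not_orP[_ /contrapT]. Qed.

Lemma nonunit_prime x y : nonunit O (x * y) -> ~ nonunit O x -> nonunit O y.
Proof.
move=> Nxy Nx; have x0 : x != 0.
  by apply/eqP => x0; apply: Nx; left.
by rewrite -(mulKf x0 y); apply: nonunitM => //; exact: unit_inv.
Qed.

Lemma nonunitX x n : nonunit O (x ^+ n) -> nonunit O x.
Proof.
elim: n => [|n IH]; first by rewrite expr0 => /nonunitN1.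
rewrite exprS => Nx; have [//|/(nonunit_prime Nx)] := pselect (nonunit O x).
exact: IH.
Qed.

Lemma valringVN x : ~ O x -> nonunit O x^-1.
Proof. by move=> Ox; right; rewrite invrK. Qed.

(** Modulo the maximal ideal this is the multiplicativity of the lowest
    coefficient. *)
Lemma lowest_unit_mul p q i j : coefs_in O p -> coefs_in O q ->
    ~ nonunit O p`_i -> (forall k, (k < i)%N -> nonunit O p`_k) ->
    ~ nonunit O q`_j -> (forall k, (k < j)%N -> nonunit O q`_k) ->
  ~ nonunit O (p * q)`_(i + j).
Proof.
move=> Op Oq pi pk qj qk.
have ii : (i < (i + j).+1)%N by rewrite ltnS leq_addr.
rewrite coefM (bigD1 (Ordinal ii)) //= addKn => N.
apply: qj; apply: nonunit_prime pi; move: N.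
set S := \sum_(_ < _ | _) _.
have NS : nonunit O S.
  apply: (ideal_sum nonunit_ideal) => k ki.
  have [lt|lt|E] := ltngtP k i.
  - by rewrite mulrC; apply: nonunitM => //; exact: pk.
  - apply: nonunitM => //; apply: qk.
    by rewrite ltn_subLR ?ltn_add2r // -ltnS.
  - by case/eqP: ki; apply: val_inj.
by move=> N; rewrite -(addrK S (_ * _)); exact: nonunitB.
Qed.

Lemma dominant_coef p : p != 0 ->
  exists2 i, p`_i != 0 & forall k, O (p`_k / p`_i).
Proof.
have O0 := subring0 rO; have O1 : O 1 by case: rO.
move=> p0.
have H n : exists2 i, p`_i != 0 & forall k, (k < n)%N -> O (p`_k / p`_i).
  elim: n => [|n [i pi0 Hi]].
    by exists (size p).-1 => //; rewrite -lead_coefE lead_coef_eq0.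
  have [Oni|] := pselect (O (p`_n / p`_i)).
    by exists i => // k; rewrite ltnS leq_eqVlt => /predU1P[->//|]; exact: Hi.
  move=> /valringVN/nonunit_sub; rewrite invf_div => Oin.
  have [pn0|pn0] := eqVneq p`_n 0.
    exists i => // k; rewrite ltnS leq_eqVlt => /predU1P[->|]; last exact: Hi.
    by rewrite pn0 mul0r.
  exists n => // k; rewrite ltnS leq_eqVlt => /predU1P[->|kn].
    by rewrite divff.
  have -> : p`_k / p`_n = p`_k / p`_i * (p`_i / p`_n) by rewrite mulrA divfK.
  by apply: subringM => //; exact: Hi.
have [i pi0 Hi] := H (size p); exists i => // k.
by have [/Hi//|kp] := ltnP k (size p); rewrite nth_default // mul0r.
Qed.

Lemma primitive_scale p : p \is monic ->
  exists a, [/\ O a, a != 0, coefs_in O (a *: p), exists i, ~ nonunit O (a *: p)`_i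
    & O a^-1 -> coefs_in O p].
Proof.
move=> pm; have p0 := monic_neq0 pm.
have [i pi0 Hi] := dominant_coef p0.
have Oa : O (p`_i)^-1.
  by have := Hi (size p).-1; rewrite -lead_coefE (monicP pm) mul1r.
exists (p`_i)^-1; split=> //; first by rewrite invr_eq0.
- by move=> k; rewrite coefZ mulrC.
- by exists i; rewrite coefZ mulVf //; exact: nonunitN1.
- rewrite invrK => Opi k; rewrite -(divfK pi0 p`_k); exact: subringM.
Qed.

Lemma first_unit p : (exists i, ~ nonunit O p`_i) ->
  exists2 i, ~ nonunit O p`_i & forall k, (k < i)%N -> nonunit O p`_k.
Proof.
move=> /least_nat[i pi H]; exists i => // k /H; exact: contrapT.
Qed.

(** Scale p and q to primitive polynomials by a and b in O. If p is not over O,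
    then a is in the maximal ideal, hence so are all the coefficients of the
    product of the scaled polynomials, against [lowest_unit_mul]. *)
Lemma gauss_monic p q : p \is monic -> q \is monic -> coefs_in O (p * q) ->
  coefs_in O p.
Proof.
move=> pm qm Opq.
have [a [Oa a0 Oap /first_unit[i api Hi] Ha]] := primitive_scale pm.
have [b [Ob b0 Obq /first_unit[j bqj Hj] _]] := primitive_scale qm.
apply: Ha; apply: contrapT => Na.
apply: (lowest_unit_mul Oap Obq api Hi bqj Hj).
rewrite -scalerAl -scalerAr !coefZ mulrCA; apply: nonunitM => //.
by rewrite mulrC; apply: nonunitM => //; right.
Qed.

(** Modulo the maximal ideal the product is a power of 'X, and so are its
    monic divisors. *)
Lemma gauss_monic_low p q : p \is monic -> q \is monic ->
    (forall i, (i < (size (p * q)%R).-1)%N -> nonunit O (p * q)`_i) ->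
  forall i, (i < (size p).-1)%N -> nonunit O p`_i.
Proof.
move=> pm qm Npq.
have pqm : p * q \is monic by rewrite monicMl.
have O0 := subring0 rO; have O1 : O 1 by case: rO.
have Opq : coefs_in O (p * q).
  move=> i; have [/Npq/nonunit_sub//|] := ltnP i (size (p * q)%R).-1.
  rewrite leq_eqVlt => /predU1P[<-|]; first by rewrite -lead_coefE (monicP pqm).
  by rewrite prednK ?size_poly_gt0 ?monic_neq0 // => ?; rewrite nth_default.
have Op := gauss_monic pm qm Opq.
have Oq : coefs_in O q by apply: (gauss_monic qm pm); rewrite mulrC.
have lead_unit r : r \is monic -> ~ nonunit O r`_(size r).-1.
  by move=> rm; rewrite -lead_coefE (monicP rm); exact: nonunitN1.
have [|i pi Hi] := @first_unit p; first by exists (size p).-1; exact: lead_unit.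
have [|j qj Hj] := @first_unit q; first by exists (size q).-1; exact: lead_unit.
have jq : (j <= (size q).-1)%N.
  by rewrite leqNgt; apply/negP => /Hj; exact: lead_unit.
have ij : ((size (p * q)%R).-1 <= i + j)%N.
  by rewrite leqNgt; apply/negP => /Npq; exact: lowest_unit_mul.
have ip : ((size p).-1 <= i)%N.
  move: ij; rewrite size_monicM ?monic_neq0 //.
  have : (0 < size p)%N by rewrite size_poly_gt0 monic_neq0.
  have : (0 < size q)%N by rewrite size_poly_gt0 monic_neq0.
  move: jq; case: (size p) (size q) => [//|m] [//|n] /=.
  by rewrite addnS /= => jn _ _ mn; rewrite -(leq_add2r j) (leq_trans _ mn) // leq_add2l.
by move=> k kp; apply: Hi; exact: leq_trans ip.
Qed.

(** If x were not in O, the equation divided by the leading power of x would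
    write 1 as a sum of nonunits. *)
Lemma valring_root p x : p \is monic -> coefs_in O p -> root p x -> O x.
Proof.
move=> pm Op /rootP px; apply: contrapT => Ox.
have x0 : x != 0 by apply/eqP => x0; apply: Ox; rewrite x0; exact: subring0.
have Nx := valringVN Ox; pose n := (size p).-1.
have sp : size p = n.+1 by rewrite prednK // size_poly_gt0 monic_neq0.
have := @rev_horner F p x^-1 n _ _.
rewrite invr_eq0 sp invrK px mulr0 => /(_ x0 (leqnn _)).
rewrite big_ord_recl /= subn0 /n -(lead_coefE p) (monicP pm) mul1r expr0.
move/esym/eqP; rewrite addr_eq0 => /eqP H.
apply: nonunitN1; rewrite H; apply: nonunitN.
apply: (ideal_sum nonunit_ideal) => i _.
rewrite /bump add1n exprS mulrCA mulrC; apply: nonunitM => //.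
by apply: subringM => //; apply: subringX => //; exact: nonunit_sub.
Qed.

End ValringTheory.

Lemma monic_division (F : fieldType) (T : set F) (p q : {poly F}) : subring T ->
    p \is monic -> coefs_in T p -> coefs_in T q ->
  exists r u : {poly F}, [/\ coefs_in T r, (size r < size p)%N & q = u * p + r].
Proof.
move=> rT pm Tp; have [n] := ubnP (size q); elim: n q => // n IH q sq Tq.
have [qp|pq] := ltnP (size q) (size p); first by exists q, 0; rewrite mul0r add0r.
have q0 : q != 0.
  rewrite -size_poly_gt0; apply: leq_trans pq.
  by rewrite size_poly_gt0 monic_neq0.
pose k := (size q - size p)%N.
pose q' := q - lead_coef q *: ('X^k * p).
have q'E i : q'`_i = q`_i - lead_coef q * (if (i < k)%N then 0 else p`_(i - k)).
  by rewrite coefB coefZ coefXnM.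
have Tq' : coefs_in T q'.
  have Tl : T (lead_coef q) by rewrite lead_coefE.
  move=> i; rewrite q'E; case: (rT) => _ TB TM; apply: TB => //; apply: TM => //.
  by case: ifP => // _; exact: subring0.
have p_gt0 : (0 < size p)%N by rewrite size_poly_gt0 monic_neq0.
have sq' : (size q' <= (size q).-1)%N.
  apply/leq_sizeP => i; rewrite q'E leq_eqVlt => /predU1P[<-|qi].
    have -> : ((size q).-1 < k)%N = false by rewrite /k; lia.
    have -> : ((size q).-1 - k)%N = (size p).-1 by rewrite /k; lia.
    by rewrite -!lead_coefE (monicP pm) mulr1 subrr.
  rewrite (nth_default _ (s := q)); last by lia.
  rewrite sub0r; case: ifP => ik; first by rewrite mulr0 oppr0.
  rewrite nth_default ?mulr0 ?oppr0 //.
  have qi' : (size q <= i)%N by lia.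
  have ki : (k <= i)%N by lia.
  have kE : (k + size p = size q)%N by rewrite /k subnK.
  by rewrite leq_subRL // kE.
have [|r [u [Tr rp ra]]] := IH q' _ Tq'.
  by apply: leq_ltn_trans sq' _; lia.
exists r, (lead_coef q *: 'X^k + u); split=> //.
by rewrite mulrDl -scalerAl -addrA -ra /q' addrC subrK.
Qed.

Section Integral.
Variables (R : comNzRingType) (F : fieldType) (j : {rmorphism R -> F}).

Lemma integral_valring O x : valring O -> (forall r, O (j r)) ->
  integralOver j x -> O x.
Proof.
move=> vO Oj [p pm px]; apply: (valring_root vO _ _ px); first exact: monic_map.
by move=> i; rewrite coef_map /=.
Qed.

(** The integral closure is the intersection of the valuation rings above: if x
    is not integral, then 1/x generates a proper ideal of the ring that it
    generates over R, and [chevalley] gives a valuation ring which excludes x. *)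
Lemma valring_integral x :
  (forall O, valring O -> (forall r, O (j r)) -> O x) -> integralOver j x.
Proof.
move=> H; have [->|x0] := eqVneq x 0; first exact: integral0.
pose A : set F := range j.
have rA : subring A.
  split; first by exists 1 => //; rewrite rmorph1.
  - by move=> _ _ [r _ <-] [s _ <-]; exists (r - s) => //; rewrite rmorphB.
  - by move=> _ _ [r _ <-] [s _ <-]; exists (r * s) => //; rewrite rmorphM.
pose B := adjoin A x^-1.
have rB : subring B by exact: adjoin_subring.
have Bx : B x^-1 by exact: adjoin_gen.
pose J := [set x^-1 * y | y in B].
have iJ : ideal B J.
  split.
  - by move=> _ [y By <-]; exact: subringM.
  - by exists 0; [exact: subring0|rewrite mulr0].
  - move=> _ _ [y By <-] [z Bz <-]; exists (y + z); last by rewrite mulrDr.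
    exact: subringD.
  - by move=> y _ By [z Bz <-]; exists (y * z); [exact: subringM|rewrite mulrCA].
have [[_ [p Ap ->]]|J1] := pselect (J 1); last first.
  have [O [vO BO JO]] := chevalley (And3 rB iJ J1).
  have Ox : O x.
    apply: H => // r; apply: BO; apply: sub_adjoin; first exact: subring0.
    by exists r.
  have /JO : J x^-1 by exists 1; [case: rB|rewrite mulr1].
  by move=> /nonunit_inv; rewrite invrK => /(_ Ox)/eqP; rewrite invr_eq0 (negPf x0).
move=> /(congr1 ( *%R (x ^+ (size p).+1))); rewrite mulr1 exprSr mulrA mulfK //.
rewrite rev_horner // => E.
pose r := \poly_(i < (size p).+1) p`_(size p - i).
have qm : 'X^((size p).+1) - r \is monic.
  by rewrite monicE lead_coefDl ?lead_coefXn // size_polyN size_polyXn ltnS size_poly.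
apply: (integral_root_monic qm).
  by rewrite rootE hornerD hornerN hornerXn horner_poly E -exprSr subrr.
apply/integral_poly => i; rewrite coefB coefXn coef_poly.
apply: integral_sub; first exact: integral_nat.
case: ifP => _; last exact: integral0.
by have [s _ <-] := Ap (size p - i)%N; exact: integral_id.
Qed.

End Integral.

(** * The residue field of a valuation ring *)

Section ResidueField.
Variables (F : fieldType) (O : set F) (vO : valring O).

(** The proof that O is a valuation ring is kept in the term, so that the ring
    structures below can be inferred from it. *)
Definition vring : {pred F} := let _ := vO in fun x => `[< O x >].

Lemma vring_closed : GRing.subring_closed vring.
Proof.
case: vO => -[O1 OB OM] _; split; first exact/asboolP.
- by move=> x y /asboolP Ox /asboolP Oy; apply/asboolP; exact: OB.
- by move=> x y /asboolP Ox /asboolP Oy; apply/asboolP; exact: OM.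
Qed.

HB.instance Definition _ := GRing.isSubringClosed.Build F vring vring_closed.

Definition vtype := {x | x \in vring}.
HB.instance Definition _ := SubChoice.on vtype.
HB.instance Definition _ := [SubChoice_isSubComNzRing of vtype by <:].

Definition vmax : {pred vtype} := fun x => `[< nonunit O (val x) >].

Lemma vmax_closed : idealr_closed vmax.
Proof.
split; first by apply/asboolP; left; rewrite rmorph0.
  by apply/asboolP; rewrite rmorph1; exact: nonunitN1.
move=> a x y /asboolP Nx /asboolP Ny; apply/asboolP.
rewrite rmorphD rmorphM; apply: nonunitD => //; apply: nonunitM => //.
exact/asboolP/(valP a).
Qed.

HB.instance Definition _ := isIdealr.Build vtype vmax vmax_closed.

Definition vres := {ideal_quot vmax}.
HB.instance Definition _ := GRing.ComNzRing.on vres.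


Definition red (x : vtype) : vres := (\pi_vres x)%qT.

HB.instance Definition _ :=
  GRing.RMorphism.copy red (fun x : vtype => (\pi_vres x)%qT).

Lemma red_eq0 x : red x = 0 <-> nonunit O (val x).
Proof.
have -> : (0 : vres) = red 0 by rewrite rmorph0.
split=> [/eqP|N]; last apply/eqP; rewrite -Quotient.idealrBE subr0 => *; exact/asboolP.
Qed.

Definition res_inv (q : vres) : vres :=
  if q == 0 then 0 else xget 0 [set r | r * q = 1].

Lemma res_mulVf q : q != 0 -> res_inv q * q = 1.
Proof.
move=> q0; rewrite /res_inv (negPf q0).
suff : [set r | r * q = 1] (xget 0 [set r | r * q = 1]) by [].
apply: xgetPex => /=; move: q0; rewrite -[q]reprK -/(red _) => q0.
set x := repr q in q0 *.
have Nx : ~ nonunit O (val x) by move=> /red_eq0 /eqP; exact/negP.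
have Ox : vring (val x)^-1 by apply/asboolP; exact: unit_inv.
exists (red (Sub (val x)^-1 Ox)); rewrite -rmorphM -(rmorph1 red); congr red.
apply: val_inj; rewrite /= mulVf //.
by apply/eqP => x0; apply: Nx; left.
Qed.

Lemma res_inv0 : res_inv 0 = 0.
Proof. by rewrite /res_inv eqxx. Qed.

HB.instance Definition _ := GRing.ComNzRing_isField.Build vres res_mulVf res_inv0.

End ResidueField.

Section PlaceOfValring.
Variables (K F : fieldType) (iota : {rmorphism K -> F}).

Section Construction.
Variables (O : set F) (vO : valring O) (OK : forall c, O (iota c)).

Definition vconst (c : K) : vtype vO := exist _ (iota c) (asboolT (OK c)).

Lemma vconst_zmod_morphism : zmod_morphism vconst.
Proof. by move=> x y; apply: val_inj; rewrite /= rmorphB. Qed.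

Lemma vconst_monoid_morphism : monoid_morphism vconst.
Proof.
by split=> [|x y]; apply: val_inj; rewrite /= ?rmorph1 ?rmorphM.
Qed.

HB.instance Definition _ :=
  GRing.isZmodMorphism.Build K (vtype vO) vconst vconst_zmod_morphism.
HB.instance Definition _ :=
  GRing.isMonoidMorphism.Build K (vtype vO) vconst vconst_monoid_morphism.

Definition vplace (x : F) : option (vres vO) :=
  omap (@red F O vO) (insub x : option (vtype vO)).

Lemma vplace_in (x : vtype vO) : vplace (val x) = Some (red x).
Proof. by rewrite /vplace valK. Qed.

Lemma vplace_some x a : vplace x = Some a -> exists2 y : vtype vO, val y = x & red y = a.
Proof. by rewrite /vplace; case: insubP => [y _ yx|//] [<-]; exists y. Qed.

Lemma vplace_neq_none x : vplace x <> None <-> O x.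
Proof.
rewrite /vplace; case: insubP => [y /asboolP Oy _|/negP Ox]; first by split.
by split=> // Ox'; case: Ox; exact/asboolP.
Qed.

(** Every valuation ring above K belongs to a place, the reduction modulo its
    maximal ideal. *)
Lemma exists_place : exists P : place iota, val_ring P = O.
Proof.
have pid c : vplace (iota c) = Some (red (vconst c)).
  exact: (vplace_in (vconst c)).
have padd x y a b : vplace x = Some a -> vplace y = Some b ->
    vplace (x + y) = Some (a + b).
  move=> /vplace_some[x' <- <-] /vplace_some[y' <- <-].
  by rewrite -rmorphD vplace_in rmorphD.
have pmul x y a b : vplace x = Some a -> vplace y = Some b ->
    vplace (x * y) = Some (a * b).
  move=> /vplace_some[x' <- <-] /vplace_some[y' <- <-].
  by rewrite -rmorphM vplace_in rmorphM.
have pinv x : vplace x = None -> vplace x^-1 = Some 0.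
  move=> xN; have Ox : ~ O x by move=> /vplace_neq_none.
  have Nx := valringVN Ox; have Ox' := nonunit_sub vO Nx.
  have /vplace_neq_none : O x^-1 by [].
  case E : (vplace x^-1) => [a|//] _; have [y yx <-] := vplace_some E.
  by congr Some; apply/red_eq0; rewrite yx.
have psurj (a : vres vO) : exists x, vplace x = Some a.
  by exists (val (repr a)); rewrite vplace_in /red reprK.
pose P := @Place K F iota (vres vO) (@red F O vO \o vconst) vplace
  pid padd pmul pinv psurj.
by exists P; apply/seteqP; split=> x /vplace_neq_none.
Qed.

End Construction.

Implicit Types P : place iota.

Lemma place_def P x : val_ring P x -> exists a, P x = Some a.
Proof. by rewrite /val_ring /=; case: (P x) => [a _|//]; exists a. Qed.

Lemma val_ring_some P x a : P x = Some a -> val_ring P x.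
Proof. by move=> Px; rewrite /val_ring /= Px. Qed.

Lemma placeN P x a : P x = Some a -> P (- x) = Some (- a).
Proof.
by move=> Px; rewrite -mulN1r -(rmorphN1 iota) (place_mul (place_id P _) Px)
  rmorphN1 mulN1r.
Qed.

Lemma place0 P : P 0 = Some 0.
Proof. by rewrite -(rmorph0 iota) place_id rmorph0. Qed.

Lemma val_ring_valring P : valring (val_ring P).
Proof.
split; last first.
  move=> x; case E : (P x) => [a|]; [left|right]; first exact: val_ring_some E.
  exact: val_ring_some (place_inv E).
split; first exact: val_ring_some (place1 P).
- move=> x y /place_def[a Pa] /place_def[b Pb].
  exact: val_ring_some (place_add Pa (placeN Pb)).
- move=> x y /place_def[a Pa] /place_def[b Pb].
  exact: val_ring_some (place_mul Pa Pb).
Qed.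

Lemma max_ideal_nonunit P : max_ideal P = nonunit (val_ring P).
Proof. by apply/seteqP; split=> x /max_idealE. Qed.

End PlaceOfValring.

(** * Polynomials in several variables *)

Section Multivariate.
Import mpoly.

Lemma leq_of_bounded_deficit a b c : (forall k, k * a <= c + k * b)%N -> (a <= b)%N.
Proof.
move=> H; rewrite leqNgt; apply/negP => ba.
have := leq_trans (leq_mul (leqnn c.+1) ba) (H c.+1).
by rewrite mulnS leq_add2r ltnn.
Qed.

(** Polynomial rings over a field are completely integrally closed. Comparing
    the leading monomials in the hypothesis for all exponents k shows that the
    leading monomial of s divides that of r; subtracting from r the multiple of
    s with the same leading term preserves the hypothesis, and the monomial
    order is well founded. *)
Lemma mpoly_almost_integral n (K : fieldType) (u r s : {mpoly K[n]}) :
    u != 0 -> s != 0 ->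
    (forall k, exists q, u * r ^+ k = q * s ^+ k) ->
  exists q, r = q * s.
Proof.
move=> u0 s0; move: {2}(mlead r) (erefl (mlead r)) => m.
elim/(@ltmwf n): m r => m IH r rm H.
have [->|r0] := eqVneq r 0; first by exists 0; rewrite mul0r.
have sr : (mlead s <= mlead r)%MM.
  apply/mnm_lepP => i; apply: (@leq_of_bounded_deficit _ _ (mlead u i)) => k.
  have [q E] := H k.
  have q0 : q != 0.
    apply/eqP => q0; move/eqP: E.
    by rewrite q0 mul0r mulf_eq0 (negPf u0) expf_eq0 (negPf r0) andbF.
  move: E => /(congr1 (@mlead n K)); rewrite !mleadM ?expf_neq0 // !mleadX //.
  move=> /mnmP/(_ i); rewrite !mnmDE !mulmnE ![(k * _)%N]mulnC => ->.
  by rewrite leq_addl.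
pose t := (mleadc r / mleadc s) *: 'X_[mlead r - mlead s] : {mpoly K[n]}.
have c0 : mleadc r / mleadc s != 0.
  by rewrite mulf_neq0 ?invr_eq0 // mleadc_eq0.
have t0 : t != 0.
  by rewrite scaler_eq0 (negPf c0) -mleadc_eq0 mleadXm mcoeffX eqxx oner_eq0.
have mt : mlead t = (mlead r - mlead s)%MM.
  by rewrite mleadZ_proper mleadXm // mcoeffX eqxx mulr1.
have mts : mlead (t * s) = mlead r by rewrite mleadM // mt submK.
have cts : mleadc (t * s) = mleadc r.
  rewrite mts -{1}(submK sr) -mt mleadcM mt mcoeffZ mcoeffX eqxx mulr1.
  by rewrite divfK // mleadc_eq0.
have [E|d0] := eqVneq (r - t * s) 0.
  by exists t; apply/eqP; rewrite -subr_eq0 E.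
have lt : (mlead (r - t * s) < mlead r)%O.
  rewrite lt_neqAle; apply/andP; split.
    apply/eqP => E; move: (d0); rewrite -mleadc_eq0 E mcoeffB -{2}mts cts.
    by rewrite subrr eqxx.
  by apply: le_trans (mleadB_le _ _) _; rewrite mts joinxx.
have [||q E] := IH _ _ (r - t * s) erefl; first by rewrite -rm.
  move=> k; rewrite exprBn mulr_sumr.
  elim/big_ind: _ => [|x y [q1 ->] [q2 ->]|i _].
  - by exists 0; rewrite mul0r.
  - by exists (q1 + q2); rewrite mulrDl.
  have [q E] := H (k - i)%N.
  exists ((-1) ^+ i * q * t ^+ i *+ 'C(k, i)).
  rewrite mulrnAr mulrnAl; congr (_ *+ _).
  have -> : s ^+ k = s ^+ (k - i) * s ^+ i by rewrite -exprD subnK // -ltnS.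
  rewrite exprMn !mulrA [u * _]mulrC -[_ * u * _]mulrA E !mulrA.
  by congr (_ * _); rewrite -!mulrA; congr (_ * (_ * _)); rewrite mulrC.
by exists (q + t); rewrite mulrDl -E subrK.
Qed.

Definition weight n (c : 'I_n -> nat) (m : 'X_{1..n}) := (\sum_(i < n) c i * m i)%N.

Lemma digits_inj N n (a b : 'I_n -> nat) :
    (forall i, a i < N)%N -> (forall i, b i < N)%N ->
  (\sum_(i < n) N ^ i * a i = \sum_(i < n) N ^ i * b i)%N -> a =1 b.
Proof.
elim: n a b => [|n IH] a b aN bN; first by move=> _ [].
have E (d : 'I_n.+1 -> nat) : (\sum_(i < n.+1) N ^ i * d i =
    d ord0 + (\sum_(i < n) N ^ i * d (lift ord0 i)) * N)%N.
  rewrite big_ord_recl expn0 mul1n big_distrl /=; congr (_ + _)%N.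
  by apply: eq_bigr => i _; rewrite /bump add1n expnS -mulnA mulnC.
rewrite !E => H.
have N0 : (0 < N)%N by apply: leq_trans (aN ord0).
have H0 : a ord0 = b ord0.
  by move/(congr1 (modn^~ N)): H; rewrite ![(_ + _ * N)%N]addnC !modnMDl !modn_small.
have H1 : (\sum_(i < n) N ^ i * a (lift ord0 i) = \sum_(i < n) N ^ i * b (lift ord0 i))%N.
  by move: H; rewrite H0 => /addnI/eqP; rewrite eqn_pmul2r // => /eqP.
move=> i; case: (unliftP ord0 i) => [i' ->|-> //].
exact: (IH _ _ (fun i => aN (lift ord0 i)) (fun i => bN (lift ord0 i)) H1 i').
Qed.

(** Kronecker's substitution: the exponents of a monomial of degree less than N
    are the digits in base N of its weight divided by e. *)
Lemma weight_inj n (K : nzRingType) (p : {mpoly K[n]}) N e :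
    (msize p <= N)%N -> (0 < e)%N ->
  {in msupp p &, injective (weight (fun i : 'I_n => e * N ^ i)%N)}.
Proof.
move=> pN e0 m m' mp m'p E.
have small x : x \in msupp p -> forall i, (x i < N)%N.
  move=> /msize_mdeg_lt xp i; apply: leq_ltn_trans (leq_trans xp pN).
  by rewrite mdegE (bigD1 i) //= leq_addr.
apply/mnmP; apply: (@digits_inj N); [exact: small|exact: small|].
apply/eqP; rewrite -(eqn_pmul2l e0) !big_distrr; apply/eqP.
have ew (x : 'X_{1..n}) : (\sum_(i < n) e * (N ^ i * x i) =
    weight (fun i : 'I_n => e * N ^ i)%N x)%N.
  by apply: eq_bigr => i _; rewrite mulnA.
by rewrite /= !ew.
Qed.

Section Substitution.
Variables (n : nat) (K : fieldType) (D : comNzRingType) (f : {rmorphism K -> D}).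
Variables (h : 'I_n -> {poly D}) (c : 'I_n -> nat).
Hypothesis hm : forall i, h i \is monic.
Hypothesis hc : forall i, size (h i) = (c i).+1.

Lemma mmap1_monic m : mmap1 h m \is monic /\ size (mmap1 h m) = (weight c m).+1.
Proof.
rewrite /mmap1 /weight; elim/big_rec2: _ => [|i d q _ [qm sq]].
  by rewrite monic1 size_poly1.
have hX : h i ^+ m i \is monic by exact: monic_exp.
split; first by rewrite monicMl.
have sX : size (h i ^+ m i) = (c i * m i).+1.
  elim: (m i) => [|k IH]; first by rewrite expr0 size_poly1 muln0.
  by rewrite exprS size_monicM ?monic_neq0 ?monic_exp // hc IH mulnS addnS.
by rewrite size_monicM ?monic_neq0 // sX sq addnS.
Qed.

(** Distinct monomials become monic polynomials of distinct degrees. *)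
Lemma lead_coef_mmap (p : {mpoly K[n]}) :
    p != 0 -> {in msupp p &, injective (weight c)} ->
  exists2 m, m \in msupp p & lead_coef (mmap (polyC \o f) h p) = f p@_m /\
    size (mmap (polyC \o f) h p) = (weight c m).+1.
Proof.
move=> p0 inj; rewrite -msupp_eq0 in p0.
have [m [mp max]] : exists m, m \in msupp p /\
    forall m', m' \in msupp p -> (weight c m' <= weight c m)%N.
  elim: (msupp p) p0 => // a s IH _.
  have [->|s0] := eqVneq s [::].
    by exists a; rewrite mem_head; split=> // m'; rewrite inE => /eqP->.
  have [m [ms Hm]] := IH s0.
  have [am|ma] := leqP (weight c a) (weight c m).
    exists m; rewrite inE ms orbT; split=> // m'.
    by rewrite inE => /predU1P[->//|]; exact: Hm.
  exists a; rewrite mem_head; split=> // m'; rewrite inE => /predU1P[->//|/Hm/leq_trans].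
  by apply; exact: ltnW.
exists m => //; rewrite /mmap (bigD1_seq m) ?msupp_uniq //=.
have fm0 m' : m' \in msupp p -> f p@_m' != 0.
  by rewrite fmorph_eq0 mcoeff_eq0 => ->.
pose term m' : {poly D} := (f p@_m')%:P * mmap1 h m'.
have sT m' : m' \in msupp p -> size (term m') = (weight c m').+1.
  move=> m'p; have [mm sm] := mmap1_monic m'.
  by rewrite size_Mmonic ?polyC_eq0 ?fm0 // sm size_polyC fm0.
have sR : (size (\sum_(m' <- msupp p | m' != m) term m')%R < size (term m))%N.
  rewrite sT // ltnS big_seq_cond.
  apply: (big_ind (fun q : {poly D} => (size q <= weight c m)%N)).
  - by rewrite size_poly0.
  - by move=> q r sq sr; apply: leq_trans (size_polyD _ _) _; rewrite geq_max sq sr.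
  move=> m' /andP[m'p m'm]; rewrite sT // ltn_neqAle max // andbT.
  by apply: contraNneq m'm => /inj ->.
have [mm _] := mmap1_monic m.
by rewrite lead_coefDl // size_polyDl // sT // lead_coef_Mmonic // lead_coefC.
Qed.

Lemma lead_coef_mmap_neq0 (p : {mpoly K[n]}) : p != 0 ->
    {in msupp p &, injective (weight c)} ->
  exists2 a, a != 0 & lead_coef (mmap (polyC \o f) h p) = f a.
Proof.
move=> p0 /(lead_coef_mmap p0)[m mp [-> _]].
by exists p@_m => //; rewrite mcoeff_eq0 mp.
Qed.

End Substitution.

Lemma mmap_coefs_in n (K F : fieldType) (iota : {rmorphism K -> F})
    (h : 'I_n -> {poly F}) (B : set F) (p : {mpoly K[n]}) :
    subring B -> (forall c, B (iota c)) -> (forall i, coefs_in B (h i)) ->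
  coefs_in B (mmap (polyC \o iota) h p).
Proof.
move=> rB BK Bh; have B0 := subring0 rB; have B1 : B 1 by case: rB.
have BM (q r : {poly F}) : coefs_in B q -> coefs_in B r -> coefs_in B (q * r).
  by move=> Bq Br i; rewrite coefM; apply: subring_sum => // k _; exact: subringM.
rewrite /mmap; elim/big_ind: _ => [i|q r Bq Br i|m _].
- by rewrite coef0.
- by rewrite coefD; exact: subringD.
apply: (BM); first by move=> i; rewrite coefC; case: ifP.
have BC1 : coefs_in B (1 : {poly F}) by move=> i; rewrite coef1; case: (i == _).
apply: (big_ind (fun q : {poly F} => coefs_in B q)) => [//|q r|i _]; first exact: BM.
by elim: (m i) => [|k IH]; rewrite ?expr0 // exprS; exact: BM.
Qed.

Lemma horner_mmap n (K F : fieldType) (iota : {rmorphism K -> F})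
    (h : 'I_n -> {poly F}) (p : {mpoly K[n]}) x :
  (mmap (polyC \o iota) h p).[x] = mmap iota (fun i => (h i).[x]) p.
Proof.
rewrite /mmap horner_sum; apply: eq_bigr => m _.
rewrite hornerM hornerC /mmap1 horner_prod; congr (_ * _).
by apply: eq_bigr => i _; rewrite horner_exp.
Qed.

Lemma alg_independent0 (K F : fieldType) (iota : {rmorphism K -> F}) (y : 'I_0 -> F) :
  alg_independent iota y.
Proof.
move=> p; suff -> : p = (mcoeff 0%MM p)%:MP.
  by rewrite mmapC => /eqP; rewrite fmorph_eq0 => /eqP ->; rewrite mpolyC0.
apply/mpolyP => d; rewrite mcoeffC; have -> : d = 0%MM by apply/mnmP; case.
by rewrite eqxx mulr1.
Qed.

(** Nagata's proof, valid over finite fields too: given a relation p between the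
    generators a i, the substitution a i = b i + a 0 ^ (N ^ i) turns it into an
    equation for a 0 with constant leading coefficient, so that a 0 is integral
    over the ring generated by the b i, which are one fewer. *)
Theorem noether_normalization (K F : fieldType) (iota : {rmorphism K -> F}) m
    (a : 'I_m -> F) :
  exists n (y : 'I_n -> F), [/\ alg_independent iota y,
    forall B, subring B -> (forall c, B (iota c)) -> (forall i, B (a i)) ->
      forall i, B (y i) &
    forall i, integralOver (mmap iota y) (a i)].
Proof.
elim: m a => [|m IH] a.
  by exists 0%N, a; split=> //; [exact: alg_independent0|case].
have [ai|/existsNP[p /not_implyP[pa /eqP p0]]] := pselect (alg_independent iota a).
  exists m.+1, a; split=> // i.
  have -> : a i = mmap iota a 'X_i by rewrite mmapX mmap1U.
  exact: integral_id.
pose N := (msize p).+2.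
pose b i := a (lift ord0 i) - a ord0 ^+ (N ^ (lift ord0 i)).
have [n [y [yi yB ay]]] := IH b.
have Ba (B : set F) : subring B -> (forall c, B (iota c)) -> (forall i, B (a i)) ->
    forall i, B (b i).
  move=> rB BK Ba i; rewrite /b; case: (rB) => _ BB _; apply: BB => //.
  exact: subringX.
have a0 : integralOver (mmap iota y) (a ord0).
  (* N ^ 0 = 1, so h 0 = 'X stands for a 0 itself *)
  pose h (i : 'I_m.+1) : {poly F} :=
    'X^(N ^ i) + (if unlift ord0 i is Some i' then b i' else 0)%:P.
  have Ni (i : 'I_m.+1) : (0 < N ^ i)%N by rewrite expn_gt0.
  have sh i : size (h i) = (1 * N ^ i).+1.
    rewrite size_polyDl size_polyXn ?mul1n // ltnS.
    by apply: leq_trans (size_polyC_leq1 _) _.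
  have hm i : h i \is monic.
    rewrite monicE lead_coefDl ?lead_coefXn // size_polyXn ltnS.
    by apply: leq_trans (size_polyC_leq1 _) _.
  have [|c c0 lc] := @lead_coef_mmap_neq0 _ _ _ iota h _ hm sh p p0.
    by apply: weight_inj; rewrite // ltnW.
  pose q := mmap (polyC \o iota) h p.
  have qa : q.[a ord0] = 0.
    rewrite /q horner_mmap -pa; congr mmap; apply/funext => i.
    rewrite hornerD hornerC hornerXn; case: unliftP => [i' ->|->].
      by rewrite /b addrC subrK.
    by rewrite expn0 expr1 addr0.
  have qm : (iota c)^-1 *: q \is monic.
    by rewrite monicE lead_coefZ lc mulVf // fmorph_eq0.
  apply: (integral_root_monic qm); first by rewrite rootE hornerZ qa mulr0.
  apply/integral_poly => i; apply: valring_integral => O vO Oj.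
  have rO : subring O by case: vO.
  have OK c' : O (iota c') by rewrite -(mmapC y iota); exact: Oj.
  rewrite coefZ -fmorphV; apply: subringM => //.
  apply: mmap_coefs_in => // k l; rewrite coefD coefXn coefC.
  apply: subringD => //; first by case: eqP => _; [case: rO|exact: subring0].
  case: eqP => _; last exact: subring0.
  by case: unliftP => [k' _|_]; [exact: integral_valring (ay k')|exact: subring0].
exists n, y; split=> // [B rB BK B'a|i]; first by apply: yB => //; exact: Ba.
case: (unliftP ord0 i) => [i' ->|-> //].
have -> : a (lift ord0 i') = b i' + a ord0 ^+ (N ^ (lift ord0 i')).
  by rewrite subrK.
apply: integral_add => //; elim: (N ^ _)%N => [|k IHk].
  by rewrite expr0; exact: integral1.
by rewrite exprS; exact: integral_mul.
Qed.

End Multivariate.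

(** * Lacunary power series arcs *)

Section Arc.
Import mpoly.

Section Congruence.
Variables (k : nzRingType) (N : nat).
Implicit Types p q : {poly k}.

Definition eq_upto p q := forall j, (j < N)%N -> p`_j = q`_j.

Lemma eq_upto_refl p : eq_upto p p. Proof. by []. Qed.

Lemma eq_uptoD p p' q q' : eq_upto p p' -> eq_upto q q' -> eq_upto (p + q) (p' + q').
Proof. by move=> pp qq j jN; rewrite !coefD pp ?qq. Qed.

Lemma eq_uptoM p p' q q' : eq_upto p p' -> eq_upto q q' -> eq_upto (p * q) (p' * q').
Proof.
move=> pp qq j jN; rewrite !coefM; apply: eq_bigr => i _.
rewrite pp ?qq //; first by apply: leq_ltn_trans jN; exact: leq_subr.
by apply: leq_ltn_trans jN; rewrite -ltnS.
Qed.

Lemma eq_upto_mmap n (K : nzRingType) (f : K -> {poly k}) (h h' : 'I_n -> {poly k}) r :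
  (forall i, eq_upto (h i) (h' i)) -> eq_upto (mmap f h r) (mmap f h' r).
Proof.
move=> hh; apply: (big_ind2 eq_upto) => [||m _]; first exact: eq_upto_refl.
  by move=> *; exact: eq_uptoD.
apply: eq_uptoM => //.
apply: (big_ind2 eq_upto) => [||i _]; first exact: eq_upto_refl.
  by move=> *; exact: eq_uptoM.
elim: (m i) => [|d IH]; first by rewrite !expr0.
by rewrite !exprS; exact: eq_uptoM.
Qed.

End Congruence.

(** The growth is such that a polynomial of degree at most l in the n
    coordinates of the l-th truncation of the arc has degree less than
    [gap n l.+1]. *)
Fixpoint gap n l : nat := if l is l'.+1 then (l * (gap n l') ^ n.+1).+1 else 1%N.

Lemma gap_gt n l : (l < gap n l)%N.
Proof.
case: l => [//|l] /=; rewrite ltnS leq_pmulr // expn_gt0.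
by case: l => //=.
Qed.

Lemma gap_exp n l i : (gap n l <= gap n l ^ i.+1)%N.
Proof. by rewrite expnS leq_pmulr // expn_gt0 (leq_ltn_trans _ (gap_gt n l)). Qed.

Lemma gap_mono n : {homo gap n : l m / (l < m)%N >-> (l < m)%N}.
Proof.
apply: homo_ltn => [? ? ?|l]; first exact: ltn_trans.
rewrite /= ltnS; apply: leq_trans (gap_exp n l n) _.
by rewrite leq_pmull.
Qed.

Variables (n : nat) (K k : fieldType) (emb : {rmorphism K -> k}) (y0 : 'I_n -> k).

Definition lacunary_exp l (i : 'I_n) := (gap n l * gap n l ^ i)%N.

(** The truncations of the arc t |-> y0 i + sum over l' of
    t ^ lacunary_exp l' i, whose constant term is the point y0. *)
Definition arc_point l (i : 'I_n) : {poly k} :=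
  (y0 i)%:P + \sum_(l' < l.+1) 'X^(lacunary_exp l' i).

Definition arc l (r : {mpoly K[n]}) : {poly k} := mmap (polyC \o emb) (arc_point l) r.

Lemma lacunary_exp_ge l i : (gap n l <= lacunary_exp l i)%N.
Proof. by rewrite /lacunary_exp -expnS gap_exp. Qed.

Lemma lacunary_exp_mono l m i : (l < m)%N -> (lacunary_exp l i < lacunary_exp m i)%N.
Proof.
move=> /(gap_mono n) lm; rewrite /lacunary_exp -!expnS ltn_exp2r //.
Qed.

Lemma arc_point_top l i :
  size (arc_point l i) = (lacunary_exp l i).+1 /\ arc_point l i \is monic.
Proof.
rewrite /arc_point big_ord_recr /= addrA [_ + 'X^_]addrC.
set q := (y0 i)%:P + _.
have sq : (size q < size ('X^(lacunary_exp l i) : {poly k}))%N.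
  rewrite size_polyXn ltnS; apply: leq_trans (size_polyD _ _) _.
  rewrite geq_max; apply/andP; split.
    apply: leq_trans (size_polyC_leq1 _) _.
    by apply: leq_trans (lacunary_exp_ge l i); exact: leq_ltn_trans (gap_gt n l).
  apply: (big_ind (fun q : {poly k} => (size q <= lacunary_exp l i)%N)).
  - by rewrite size_poly0.
  - by move=> r s sr ss; apply: leq_trans (size_polyD _ _) _; rewrite geq_max sr ss.
  by move=> l' _; rewrite size_polyXn; exact: lacunary_exp_mono.
by rewrite size_polyDl // size_polyXn monicE lead_coefDl // lead_coefXn.
Qed.

Lemma arc_stable l m r : (l <= m)%N -> eq_upto (gap n l.+1) (arc m r) (arc l r).
Proof.
move=> lm; apply: eq_upto_mmap => i; rewrite /arc_point.
apply: eq_uptoD; first exact: eq_upto_refl.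
rewrite -(subnKC lm); elim: (m - l)%N => [|d IH]; first by rewrite addn0.
rewrite addnS big_ord_recr /= -[X in eq_upto _ _ X]addr0; apply: eq_uptoD => //.
move=> j jl; rewrite coefXn coef0.
have le : (gap n l.+1 <= gap n (l + d).+1)%N.
  by apply: (ltnW_homo (@gap_mono n)); rewrite ltnS leq_addr.
have lt : (j < lacunary_exp (l + d).+1 i)%N.
  exact: leq_trans jl (leq_trans le (lacunary_exp_ge _ _)).
by rewrite ltn_eqF.
Qed.

(** The i-th coefficient of r along the arc. By [arc_stable] any truncation of
    index at least i computes it. *)
Definition arc_coef (r : {mpoly K[n]}) i := (arc i r)`_i.

Lemma arc_coefE r i l : (i <= l)%N -> (arc l r)`_i = arc_coef r i.
Proof.
move=> il; apply: (arc_stable r il); apply: ltn_trans (gap_gt _ _).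
exact: ltnSn.
Qed.

Lemma arc_coefB r s i : arc_coef (r - s) i = arc_coef r i - arc_coef s i.
Proof. by rewrite /arc_coef /arc rmorphB coefB. Qed.

Lemma arc_coefM r s i :
  arc_coef (r * s) i = \sum_(j < i.+1) arc_coef r j * arc_coef s (i - j).
Proof.
rewrite /arc_coef {1}/arc rmorphM coefM; apply: eq_bigr => j _.
by rewrite !arc_coefE ?leq_subr // -ltnS.
Qed.

Lemma arc_coefZ c r i : arc_coef (c *: r) i = emb c * arc_coef r i.
Proof. by rewrite /arc_coef /arc mmapZ coefCM. Qed.

Lemma arc_coef0 r : arc_coef r 0 = mmap emb y0 r.
Proof.
rewrite /arc_coef -horner_coef0 horner_mmap; congr mmap; apply/funext => i.
rewrite hornerD hornerC big_ord1 hornerXn expr0n.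
have := lacunary_exp_ge 0 i; case: (lacunary_exp _ _) => // d _.
by rewrite addr0.
Qed.

Lemma arc_coef_in (B : set k) r i : subring B -> (forall c, B (emb c)) ->
  (forall l, B (y0 l)) -> B (arc_coef r i).
Proof.
move=> rB BK By; apply: mmap_coefs_in => // l j.
have B0 := subring0 rB; have B1 : B 1 by case: rB.
rewrite coefD coefC; apply: subringD => //; first by case: ifP.
rewrite coef_sum; apply: subring_sum => // d _; rewrite coefXn.
by case: (_ == _).
Qed.

(** The arc has algebraically independent coordinates: the l-th truncation does
    not annihilate r when l exceeds the degree of r, by Kronecker's
    substitution, and its value at r has smaller degree than the first power of
    t that later truncations can affect. *)
Lemma arc_coef_neq0 r : r != 0 -> exists i, arc_coef r i != 0.
Proof.
move=> r0; pose l := msize r.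
have wi : {in msupp r &, injective (weight (lacunary_exp l))}.
  apply: weight_inj; first by apply: ltnW; exact: gap_gt.
  exact: leq_ltn_trans (gap_gt n l).
have [m mr [lc sz]] := lead_coef_mmap emb (fun i => (arc_point_top l i).2)
  (fun i => (arc_point_top l i).1) r0 wi.
exists (weight (lacunary_exp l) m).
pose w := weight (lacunary_exp l) m.
have wl : (w < gap n l.+1)%N.
  rewrite /= ltnS; apply: (@leq_trans (\sum_(i < n) gap n l ^ n.+1 * m i)%N).
    apply: leq_sum => i _; rewrite leq_mul2r /lacunary_exp -expnS.
    apply/orP; right; rewrite leq_pexp2l ?ltnS //.
      exact: leq_ltn_trans (gap_gt n l).
    exact: ltnW.
  rewrite -big_distrr /= mulnC leq_mul2r; apply/orP; right.
  by rewrite -mdegE ltnW // ltnW // ltnS; exact: msize_mdeg_lt.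
have : (arc l r)`_w != 0.
  have -> : w = (size (arc l r)).-1 by rewrite /arc sz.
  by rewrite -lead_coefE lc fmorph_eq0 mcoeff_eq0 mr.
have [wl'|lw] := leqP w l; first by rewrite arc_coefE.
by rewrite -(arc_stable r (ltnW lw)).
Qed.

End Arc.

(** * Finite modules over a domain *)

(** Gaussian elimination without division: eliminate the first column with a
    pivot row, if there is one. *)
Lemma nontrivial_relation (R : idomainType) N (M : 'I_N.+1 -> 'I_N -> R) :
  exists2 c : 'I_N.+1 -> R, exists i, c i != 0 &
    forall l, \sum_i c i * M i l = 0.
Proof.
elim: N M => [|N IH] M.
  by exists (fun=> 1); [exists ord0; rewrite oner_neq0|case].
have [[i0 p0]|z] := pselect (exists i, M i ord0 != 0); last first.
  have [c [i ci] Hc] := IH (fun i l => M (lift ord0 i) (lift ord0 l)).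
  exists (fun i => if unlift ord0 i is Some i' then c i' else 0).
    by exists (lift ord0 i); rewrite /= liftK.
  have z' i' : M i' ord0 = 0 by apply/eqP/negPn/negP => ?; apply: z; exists i'.
  move=> l; case: (unliftP ord0 l) => [l' ->|->]; last first.
    by apply: big1 => i' _; rewrite z' mulr0.
  rewrite big_ord_recl unlift_none mul0r add0r -[RHS](Hc l').
  by apply: eq_bigr => i' _; rewrite /= liftK.
pose M' i l := M i0 ord0 * M (lift i0 i) (lift ord0 l)
  - M (lift i0 i) ord0 * M i0 (lift ord0 l).
have [c [i ci] Hc] := IH M'.
exists (fun i => if unlift i0 i is Some i' then M i0 ord0 * c i'
                 else - \sum_i' c i' * M (lift i0 i') ord0).
  by exists (lift i0 i); rewrite /= liftK mulf_neq0.
move=> l; rewrite (bigD1_ord i0) //= unlift_none.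
rewrite [X in _ + X = _](eq_bigr (fun i' => M i0 ord0 * c i' * M (lift i0 i') l));
  last by move=> i' _; rewrite liftK.
case: (unliftP ord0 l) => [l' ->|->]; last first.
  rewrite mulNr mulr_suml addrC -sumrB; apply: big1 => i' _; ring.
rewrite mulNr mulr_suml addrC -sumrB -[RHS](Hc l'); apply: eq_bigr => i' _.
rewrite /M'; ring.
Qed.

Section FiniteDimension.
Variables (R : idomainType) (F : fieldType) (j : {rmorphism R -> F}).
Hypothesis j_inj : injective j.

Definition lin_span (I : finType) (b : I -> F) : set F :=
  [set x | exists c : I -> R, x = \sum_l j (c l) * b l].

(** Adjoining a root of a monic polynomial P multiplies a generating family by
    the powers of the root below the degree of P. *)
Lemma finite_module (s : seq F) : (forall x, x \in s -> integralOver j x) ->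
  exists (I : finType) (b : I -> F), [/\ subring (lin_span b),
    forall r, lin_span b (j r) & forall x, x \in s -> lin_span b x].
Proof.
elim: s => [|a s IH] si.
  have T1 x : @lin_span 'I_1 (fun=> 1) x <-> exists r, x = j r.
    split=> [[c ->]|[r ->]]; first by exists (c ord0); rewrite big_ord1 mulr1.
    by exists (fun=> r); rewrite big_ord1 mulr1.
  exists 'I_1, (fun=> 1); split=> //; last by move=> r; apply/T1; exists r.
  split; first by apply/T1; exists 1; rewrite rmorph1.
  - by move=> _ _ /T1[r ->] /T1[r' ->]; apply/T1; exists (r - r'); rewrite rmorphB.
  - by move=> _ _ /T1[r ->] /T1[r' ->]; apply/T1; exists (r * r'); rewrite rmorphM.
have [|I [b [rT Tj Ts]]] := IH; first by move=> x xs; apply: si; rewrite inE xs orbT.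
have [p pm pa] := si a (mem_head _ _).
pose P := map_poly j p; have Pm : P \is monic by exact: monic_map.
pose b' (l : I * 'I_(size P)) := b l.1 * a ^+ l.2.
have TT' : lin_span b' = adjoin (lin_span b) a.
  apply/seteqP; split=> [_ [c ->]|_ [q Tq ->]].
    exists (\poly_(i < size P)
      (if insub i is Some i' then \sum_l j (c (l, i')) * b l else 0)).
      move=> i; rewrite coef_poly; case: ifP => _; last exact: subring0.
      by case: insub => [i'|]; [exists (fun l => c (l, i'))|exact: subring0].
    rewrite horner_poly.
    have -> : \sum_l j (c l) * b' l = \sum_l \sum_i j (c (l, i)) * b' (l, i).
      by rewrite pair_bigA; apply: eq_bigr => -[].
    rewrite exchange_big; apply: eq_bigr => i _.
    rewrite valK mulr_suml; apply: eq_bigr => l _.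
    by rewrite /b' mulrA.
  have [|r [u [Tr rP ->]]] := monic_division rT Pm _ Tq.
    by move=> i; rewrite coef_map /=.
  rewrite hornerD hornerM (rootP pa) mulr0 add0r.
  have [c Hc] := choice Tr; exists (fun l : I * 'I_(size P) => c l.2 l.1).
  rewrite (horner_coef_wide _ (ltnW rP)).
  have -> : \sum_(l : I * 'I_(size P)) j (c l.2 l.1) * b' l =
      \sum_l \sum_i j (c (nat_of_ord i) l) * b' (l, i).
    by rewrite pair_bigA; apply: eq_bigr => -[].
  rewrite exchange_big; apply: eq_bigr => i _.
  by rewrite Hc mulr_suml; apply: eq_bigr => l _; rewrite /b' mulrA.
exists (I * 'I_(size P))%type, b'; rewrite TT'.
have T0 := subring0 rT.
split; first exact: adjoin_subring.
  by move=> r; apply: sub_adjoin => //.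
move=> x; rewrite inE => /predU1P[->|xs]; first exact: adjoin_gen.
by apply: sub_adjoin => //; exact: Ts.
Qed.

(** The localization of T at the nonzero elements of R, inside F. *)
Definition fractions (T : set F) : set F :=
  [set x | exists2 r, r != 0 & T (x * j r)].

Lemma lin_span_dependent (I : finType) (b : I -> F) (x : 'I_#|I|.+1 -> F) :
  (forall i, fractions (lin_span b) (x i)) ->
  exists2 c : 'I_#|I|.+1 -> R, exists i, c i != 0 & \sum_i j (c i) * x i = 0.
Proof.
move=> Sx.
have {}Sx i : exists rc : R * (I -> R),
    rc.1 != 0 /\ x i * j rc.1 = \sum_l j (rc.2 l) * b l.
  by have [r r0 [c E]] := Sx i; exists (r, c).
have [rc Hrc] := choice Sx.
have [c [i0 c0] Hc] := nontrivial_relation (fun i l => (rc i).2 (enum_val l)).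
exists (fun i => c i * (rc i).1).
  by exists i0; rewrite mulf_neq0 //; case: (Hrc i0).
have -> : \sum_i j (c i * (rc i).1) * x i = \sum_i \sum_l j (c i * (rc i).2 l) * b l.
  apply: eq_bigr => i _; rewrite rmorphM -mulrA [_ * x i]mulrC (Hrc i).2 mulr_sumr.
  by apply: eq_bigr => l _; rewrite rmorphM mulrA.
rewrite exchange_big big1 // => l _; rewrite -mulr_suml -rmorph_sum.
by have := Hc (enum_rank l); rewrite enum_rankK => ->; rewrite rmorph0 mul0r.
Qed.

(** The powers of an element t of T are linearly dependent over R; a relation
    divided by the lowest power of t that occurs gives an inverse of t. *)
Lemma fractions_subfield (I : finType) (b : I -> F) (T := lin_span b) :
    subring T -> (forall r, T (j r)) ->
  [/\ subring (fractions T), forall x, fractions T x -> fractions T x^-1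
    & T `<=` fractions T].
Proof.
move=> rT Tj.
have TS : T `<=` fractions T.
  by move=> x Tx; exists 1; rewrite ?oner_neq0 // rmorph1 mulr1.
have Sj x r : r != 0 -> fractions T (x * j r) -> fractions T x.
  move=> r0 [r' r'0 Tx]; exists (r * r'); first exact: mulf_neq0.
  by rewrite rmorphM mulrA.
split=> //.
  split; first by apply: TS; case: rT.
  - move=> x y [r r0 Tx] [r' r'0 Ty]; exists (r * r'); first exact: mulf_neq0.
    have -> : (x - y) * j (r * r') = x * j r * j r' - y * j r' * j r.
      by rewrite rmorphM mulrBl; congr (_ - _); rewrite -!mulrA // [j r * _]mulrC.
    by case: (rT) => _ TB TM; apply: TB; apply: TM.
  - move=> x y [r r0 Tx] [r' r'0 Ty]; exists (r * r'); first exact: mulf_neq0.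
    by rewrite rmorphM mulrACA; exact: subringM.
move=> x Sx; have [->|x0] := eqVneq x 0.
  by rewrite invr0; apply: TS; exact: subring0.
have [r r0 Tx] := Sx.
suff [r' r'0 Ty] : fractions T (x * j r)^-1.
  exists r' => //; have -> : x^-1 * j r' = (x * j r)^-1 * j r' * j r.
    have jr0 : j r != 0 by rewrite -(rmorph0 j) (inj_eq j_inj).
    by field; rewrite x0 jr0.
  exact: subringM.
move: {x x0 Sx r r0} (x * j r) Tx => t Tt.
have [->|t0] := eqVneq t 0; first by rewrite invr0; apply: TS; exact: subring0.
have [|c [i1 c1] Hc] := @lin_span_dependent I b (fun i => t ^+ i).
  by move=> i; apply: TS; exact: subringX.
pose p := \poly_(i < #|I|.+1) c (inord i).
have pt : (map_poly j p).[t] = 0.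
  rewrite -Hc (@horner_coef_wide _ #|I|.+1); last first.
    by apply: leq_trans (size_poly _ _); exact: size_poly.
  by apply: eq_bigr => i _; rewrite coef_map coef_poly ltn_ord inord_val.
have [|i0 pi0 Hi0] := @least_nat (fun i => p`_i != 0).
  by exists i1; rewrite coef_poly ltn_ord inord_val.
pose q := drop_poly i0 p.
have pq : p = q * 'X^i0.
  rewrite -{1}(poly_take_drop i0 p) (_ : take_poly i0 p = 0) ?add0r //.
  apply/polyP => i; rewrite coef_take_poly coef0; case: ifP => // /Hi0/negP.
  by rewrite negbK => /eqP.
have qt : (map_poly j q).[t] = 0.
  move: pt; rewrite pq rmorphM /= map_polyXn hornerM hornerXn => /eqP.
  by rewrite mulf_eq0 expf_eq0 (negPf t0) andbF orbF => /eqP.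
pose s := drop_poly 1 q.
have qs : q = s * 'X + (q`_0)%:P.
  rewrite /s; apply/polyP => i; move: q {pq qt s} => q.
  rewrite coefD coefMX coefC coef_drop_poly.
  by case: i => [|i] /=; rewrite ?add0r // addr0 addn1.
exists q`_0; first by rewrite coef_drop_poly add0n.
have -> : t^-1 * j q`_0 = - (map_poly j s).[t].
  move: qt; rewrite {1}qs rmorphD rmorphM /= map_polyX map_polyC.
  rewrite hornerD hornerM hornerX hornerC => /eqP; rewrite addrC addr_eq0 => /eqP ->.
  by rewrite mulrN mulrCA mulVf // mulr1.
apply: subringN => //; apply: subring_horner => // i.
by rewrite coef_map /=.
Qed.

End FiniteDimension.

(** * Specialization to an algebraic point *)

Section Specialization.
Import mpoly.
Variables (K F : fieldType) (iota : {rmorphism K -> F}).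

Lemma place_horner (P : place iota) (p : {poly F}) (q : {poly residue P}) x a :
  (forall i, P p`_i = Some q`_i) -> P x = Some a -> P p.[x] = Some q.[a].
Proof.
move=> Ppq Px; rewrite (@horner_coef_wide _ (maxn (size p) (size q)) p) ?leq_maxl //.
rewrite (@horner_coef_wide _ (maxn (size p) (size q)) q) ?leq_maxr //.
apply: (big_ind2 (fun u v => P u = Some v)) => [||i _]; first exact: place0.
  by move=> *; exact: place_add.
apply: place_mul => //; elim: (i : nat) => [|d IH].
  by rewrite !expr0 place1.
by rewrite !exprS; exact: place_mul.
Qed.

Lemma place_mmap (P : place iota) n (y : 'I_n -> F) (a : 'I_n -> residue P)
    (r : {mpoly K[n]}) :
  (forall i, P (y i) = Some (a i)) ->
  P (mmap iota y r) = Some (mmap (residue_emb P) a r).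
Proof.
move=> Py; apply: (big_ind2 (fun u v => P u = Some v)) => [||m _].
- exact: place0.
- by move=> *; exact: place_add.
apply: place_mul; first exact: place_id.
apply: (big_ind2 (fun u v => P u = Some v)) => [||i _]; first exact: place1.
  by move=> *; exact: place_mul.
elim: (m i) => [|d IH]; first by rewrite !expr0 place1.
by rewrite !exprS; exact: place_mul.
Qed.

(** A specialization P' of P at which the a i have algebraic residues. Normalize
    the ring generated by the residues of the a i at P: it is integral over a
    polynomial ring K[y]. The pair of the elements of F with residue in K[y],
    and of those with residue in the ideal generated by y, is dominated by a
    valuation ring, at which the a i reduce to roots of monic polynomials over
    K[y] / (y) = K. *)
Theorem algebraic_specialization (P : place iota) m (a : 'I_m -> F) :
    (forall i, val_ring P (a i)) ->
  exists P' : place iota, [/\ forall x, max_ideal P x -> max_ideal P' x,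
    forall i, val_ring P' (a i) &
    forall i b, P' (a i) = Some b -> integralOver (residue_emb P') b].
Proof.
move=> Pa; have [abar Habar] := choice (fun i => place_def (Pa i)).
have [n [y [yi _ ay]]] := noether_normalization (residue_emb P) abar.
pose j := mmap (residue_emb P) y : {rmorphism {mpoly K[n]} -> residue P}.
have j_inj : injective j.
  move=> r s rs; apply/eqP; rewrite -subr_eq0; apply/eqP; apply: yi.
  by rewrite rmorphB /=; apply/eqP; rewrite subr_eq0; apply/eqP.
have jC c : j c%:MP = residue_emb P c by rewrite /j /= mmapC.
pose B : set F := [set x | exists r, P x = Some (j r)].
pose J : set F := [set x | exists2 r, mcoeff 0%MM r = 0 & P x = Some (j r)].
have rB : subring B.
  split; first by exists 1; rewrite rmorph1 place1.
  - move=> u v [r ur] [s vs]; exists (r - s); rewrite rmorphB.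
    by apply: place_add => //; exact: placeN.
  - by move=> u v [r ur] [s vs]; exists (r * s); rewrite rmorphM; exact: place_mul.
have iJ : ideal B J.
  split.
  - by move=> u [r _ ur]; exists r.
  - by exists 0; rewrite ?rmorph0 // place0.
  - move=> u v [r r0 ur] [s s0 vs]; exists (r + s); first by rewrite mcoeffD r0 s0 addr0.
    by rewrite rmorphD; exact: place_add.
  - move=> u v [r ur] [s s0 vs]; exists (r * s); first by rewrite rmorphM /= s0 mulr0.
    by rewrite rmorphM; exact: place_mul.
have J1 : ~ J 1.
  move=> [r r0]; rewrite place1 -(rmorph1 j) => -[/j_inj E].
  by move: r0; rewrite -E mcoeff1 eqxx => /eqP; rewrite oner_eq0.
have [O [vO BO JO]] := chevalley (And3 rB iJ J1).
have BK c : B (iota c) by exists c%:MP; rewrite jC place_id.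
have [P' P'O] := exists_place vO (fun c => BO _ (BK c)).
have JM x : J x -> max_ideal P' x by rewrite max_ideal_nonunit P'O; exact: JO.
have PM x : max_ideal P x -> J x.
  by move=> Px; exists 0; rewrite ?mcoeff0 // rmorph0.
have lift i : exists (p : {poly {mpoly K[n]}}) (G : {poly F}),
    [/\ p \is monic, root (map_poly j p) (abar i), G \is monic &
       forall l, P G`_l = Some (j p`_l)].
  have [p pm pa] := ay i; exists p.
  have ex l : exists x, P x = Some (j p`_l) /\ (p`_l = 1 -> x = 1).
    have [->|p1] := pselect (p`_l = 1); first by exists 1; rewrite rmorph1 place1.
    by have [x Px] := place_surj (j p`_l); exists x; split.
  have [x Hx] := choice ex; exists (\poly_(l < size p) x l).
  have x1 : x (size p).-1 = 1 by apply: (Hx _).2; rewrite -lead_coefE (monicP pm).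
  have p0 : (0 < size p)%N by rewrite size_poly_gt0 monic_neq0.
  split=> //; first by rewrite monicE lead_coef_poly ?x1 ?oner_neq0.
  move=> l; rewrite coef_poly; case: ifP => [_|lp]; first by case: (Hx l).
  by rewrite nth_default ?rmorph0 ?place0 // leqNgt lp.
have Ga i p (G : {poly F}) : root (map_poly j p) (abar i) ->
    (forall l, P G`_l = Some (j p`_l)) -> max_ideal P G.[a i].
  move=> /rootP pa PG; rewrite /max_ideal /= -pa; apply: place_horner => // l.
  by rewrite coef_map.
have aO i : val_ring P' (a i).
  rewrite P'O; have [p [G [pm pa Gm PG]]] := lift i.
  have GB l : B G`_l by exists p`_l.
  have NG : B G.[a i].
    by have [JB _ _ _] := iJ; apply: JB; apply: PM; exact: Ga PG.
  have sG : (1 < size G)%N.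
    rewrite ltnNge; apply/negP => /size1_polyC GC.
    have G1 : G`_0 = 1 by move/monicP: Gm; rewrite GC lead_coefC coefC.
    have := Ga i p G pa PG; rewrite GC hornerC G1 /max_ideal /= place1 => -[] /eqP.
    by rewrite oner_eq0.
  apply: (@valring_root _ _ vO (G - G.[a i]%:P)).
  - rewrite monicE lead_coefDl ?(monicP Gm) // size_polyN.
    by apply: leq_ltn_trans sG; exact: size_polyC_leq1.
  - move=> l; apply: BO; rewrite coefB coefC; case: (rB) => _ BB _; apply: BB => //.
    by case: ifP => // _; exact: subring0.
  - by rewrite rootE !hornerE subrr.
exists P'; split=> //; first by move=> x /PM/JM.
move=> i b P'a; have [p [G [pm pa Gm PG]]] := lift i.
exists (map_poly (mcoeff 0%MM) p).
  exact: monic_map.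
have : max_ideal P' G.[a i] by apply: JM; apply: PM; exact: Ga PG.
rewrite /max_ideal /= (@place_horner P' G
  (map_poly (residue_emb P') (map_poly (mcoeff 0%MM) p)) _ b) //.
  by move=> [E]; rewrite rootE E.
move=> l; rewrite !coef_map /=.
have : max_ideal P' (G`_l - iota (mcoeff 0%MM p`_l)).
  apply: JM; exists (p`_l - (mcoeff 0%MM p`_l)%:MP).
    by rewrite mcoeffB mcoeffC eqxx mulr1 subrr.
  rewrite rmorphB jC; apply: place_add => //; apply: placeN; exact: place_id.
move=> H; have := place_add H (place_id P' (mcoeff 0%MM p`_l)).
by rewrite subrK add0r.
Qed.

End Specialization.

(** * The valuation of an injective map to power series *)

Section SeriesValuation.
Variables (R : idomainType) (F k : fieldType) (j : {rmorphism R -> F}).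
Hypothesis j_inj : injective j.
(** The sequence c r lists the coefficients of the image of r in power series
    over k; the hypotheses say that c is an injective ring morphism. *)
Variable c : R -> nat -> k.
Hypothesis cB : forall r s i, c (r - s) i = c r i - c s i.
Hypothesis cM : forall r s i, c (r * s) i = \sum_(l < i.+1) c r l * c s (i - l).
Hypothesis c_neq0 : forall r, r != 0 -> exists i, c r i != 0.
Implicit Types (r s : R).

Definition ord_ge r m := forall i, (i < m)%N -> c r i = 0.
Definition ord_eq r m := ord_ge r m /\ c r m != 0.

Lemma c0 i : c 0 i = 0.
Proof. by rewrite -(subrr 0) cB subrr. Qed.

Lemma cD r s i : c (r + s) i = c r i + c s i.
Proof. by have := cB (r + s) s i; rewrite addrK => ->; rewrite subrK. Qed.

Lemma ord_geB r s m : ord_ge r m -> ord_ge s m -> ord_ge (r - s) m.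
Proof. by move=> rm sm i im; rewrite cB rm ?sm // subrr. Qed.

Lemma ord_geM r s m l : ord_ge r m -> ord_ge s l -> ord_ge (r * s) (m + l).
Proof.
move=> rm sl i im; rewrite cM big1 // => d _.
have [dm|md] := ltnP d m; first by rewrite rm ?mul0r.
by rewrite sl ?mulr0 //; have := ltn_ord d; lia.
Qed.

Lemma ord_eqM r s m l : ord_eq r m -> ord_eq s l -> ord_eq (r * s) (m + l).
Proof.
move=> [rm r0] [sl s0]; split; first exact: ord_geM.
have ml : (m < (m + l).+1)%N by lia.
rewrite cM (bigD1 (Ordinal ml)) //= addKn big1 ?addr0 ?mulf_neq0 //.
move=> i im; have [lt|gt|E] := ltngtP i m; first by rewrite rm ?mul0r.
  by rewrite sl ?mulr0 //; have := ltn_ord i; lia.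
by case/eqP: im; exact: val_inj.
Qed.

Lemma ord_eq_neq0 r m : ord_eq r m -> r != 0.
Proof. by move=> [_]; apply: contraNneq => ->; rewrite c0. Qed.

Lemma ord_eq_exists r : r != 0 -> exists m, ord_eq r m.
Proof.
move=> /c_neq0/least_nat[m rm min]; exists m; split=> // i /min/negP.
by rewrite negbK => /eqP.
Qed.

Lemma ord_eq_le r m l : ord_eq r m -> ord_ge r l -> (l <= m)%N.
Proof. by move=> [_ r0] rl; rewrite leqNgt; apply/negP => /rl/eqP; apply/negP. Qed.

Lemma ord_eq_uniq r m l : ord_eq r m -> ord_eq r l -> m = l.
Proof.
move=> rm rl; apply/eqP; rewrite eqn_leq.
by rewrite (ord_eq_le rl rm.1) (ord_eq_le rm rl.1).
Qed.

Lemma ord_eq_image_neq0 r m : ord_eq r m -> j r != 0.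
Proof. by move=> rm; rewrite -(rmorph0 j) (inj_eq j_inj) (ord_eq_neq0 rm). Qed.

(** The fractions of order at least d: for d = 0 the valuation ring that power
    series induce on the fraction field of R, and for d = 1 its maximal ideal. *)
Definition series_frac d : set F :=
  [set x | exists r s m, [/\ ord_eq s m, ord_ge r (m + d) & x = j r / j s]].

Definition series_ring := series_frac 0.
Definition series_max := series_frac 1.

Lemma series_fracB d x y : series_frac d x -> series_frac d y -> series_frac d (x - y).
Proof.
move=> [r [s [m [sm rm ->]]]] [r' [s' [m' [sm' rm' ->]]]].
exists (r * s' - r' * s), (s * s'), (m + m')%N; split; first exact: ord_eqM.
  apply: ord_geB.
    by rewrite addnAC; apply: ord_geM => //; case: sm'.
  by rewrite [(m + m')%N]addnC addnAC; apply: ord_geM => //; case: sm.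
rewrite rmorphB !rmorphM.
by field; rewrite (ord_eq_image_neq0 sm) (ord_eq_image_neq0 sm').
Qed.

Lemma series_fracM d x y : series_ring x -> series_frac d y -> series_frac d (x * y).
Proof.
move=> [r [s [m [sm rm ->]]]] [r' [s' [m' [sm' rm' ->]]]].
exists (r * r'), (s * s'), (m + m')%N; split; first exact: ord_eqM.
  by rewrite -addnA; apply: ord_geM => //; rewrite -[m]addn0.
by rewrite !rmorphM invfM mulrACA.
Qed.

Lemma ord_eq1 : ord_eq 1 0.
Proof.
have [m m1] := ord_eq_exists (oner_neq0 R).
have := ord_eqM m1 m1; rewrite mulr1 => /(ord_eq_uniq m1).
move=> E; have E0 : m = 0%N by lia.
by rewrite E0 in m1.
Qed.

Lemma series_ring_gen r : series_ring (j r).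
Proof. by exists r, 1, 0%N; split=> //; [exact: ord_eq1|rewrite rmorph1 divr1]. Qed.

Lemma series_max_gen r : c r 0 = 0 -> series_max (j r).
Proof.
move=> r0; exists r, 1, 0%N; split; [exact: ord_eq1| |by rewrite rmorph1 divr1].
by case.
Qed.

Lemma series_max_sub : series_max `<=` series_ring.
Proof.
move=> _ [r [s [m [sm rm ->]]]]; exists r, s, m; split=> // i im; apply: rm; lia.
Qed.

Lemma series_subring : subring series_ring.
Proof.
split; first by rewrite -(rmorph1 j); exact: series_ring_gen.
  by move=> x y; exact: series_fracB.
by move=> x y; exact: series_fracM.
Qed.

Lemma series_ideal : ideal series_ring series_max.
Proof.
have m0 : series_max 0.
  by rewrite -(rmorph0 j); apply: series_max_gen; rewrite c0.
split; [exact: series_max_sub|exact: m0| |by move=> x y; exact: series_fracM].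
move=> x y mx my; rewrite -(opprK y); apply: series_fracB => //.
by rewrite -sub0r; exact: series_fracB.
Qed.

Lemma series_max_neq1 : ~ series_max 1.
Proof.
move=> [r [s [m [sm rm E]]]]; have sr : s = r.
  by apply: j_inj; rewrite -[LHS]mul1r E divfK // (ord_eq_image_neq0 sm).
by have := ord_eq_le sm (l := m + 1) _; rewrite sr => /(_ rm); rewrite addn1 ltnn.
Qed.

Lemma series_pair : proper_pair series_ring series_max.
Proof. by split; [exact: series_subring|exact: series_ideal|exact: series_max_neq1]. Qed.

Lemma series_ring_inv x : series_ring x -> ~ series_max x -> series_ring x^-1.
Proof.
move=> [r [s [m [sm rm ->]]]] Nx; rewrite invf_div.
exists s, r, m; split=> //; last by rewrite addn0; case: sm.
split; first by move=> i im; apply: rm; lia.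
apply/eqP => rm0; apply: Nx; exists r, s, m; split=> // i; rewrite addn1 ltnS.
by rewrite leq_eqVlt => /predU1P[->//|im]; apply: rm; lia.
Qed.

Section Dominating.
Variable Q : set F.
Hypothesis vQ : valring Q.
Hypothesis OQ : series_ring `<=` Q.
Hypothesis MQ : series_max `<=` nonunit Q.

Lemma dominating_gen r : Q (j r). Proof. by apply: OQ; exact: series_ring_gen. Qed.

Lemma dominating_nonunit x : series_ring x -> nonunit Q x -> series_max x.
Proof.
move=> Ox Nx; apply: contrapT => Mx.
have /OQ Qx := series_ring_inv Ox Mx.
apply: Mx; rewrite (nonunit_inv Nx Qx) -(rmorph0 j); apply: series_max_gen.
exact: c0.
Qed.

Lemma dominating_gen_nonunit r : nonunit Q (j r) <-> c r 0 = 0.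
Proof.
split=> [|/series_max_gen]; last exact: MQ.
move=> /(dominating_nonunit (series_ring_gen r))[r' [s [m [sm rm E]]]].
have sr : r * s = r'.
  by apply: j_inj; rewrite rmorphM E divfK // (ord_eq_image_neq0 sm).
have [->|r0] := eqVneq r 0; first exact: c0.
have [l rl] := ord_eq_exists r0.
have := ord_eq_le (ord_eqM rl sm) (l := m + 1) _; rewrite sr => /(_ rm).
by case: rl => rl _; rewrite addnC leq_add2r => l0; exact: rl.
Qed.

Lemma dominating_frac r s m l : ord_eq r m -> ord_eq s l ->
  (Q (j r / j s) <-> (l <= m)%N).
Proof.
move=> rm sl; split=> [Qrs|lm].
  rewrite leqNgt; apply/negP => ml.
  have : series_max (j s / j r).
    by exists s, r, m; split=> // i im; case: sl => sl _; apply: sl; lia.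
  move=> /MQ/nonunit_inv; rewrite invf_div => /(_ Qrs)/eqP.
  by rewrite mulf_eq0 invr_eq0 (negPf (ord_eq_image_neq0 sl)) (negPf (ord_eq_image_neq0 rm)).
apply: OQ; exists r, s, l; split=> // i il; case: rm => rm _; apply: rm; lia.
Qed.

End Dominating.

Lemma dominating_exists :
  exists Q, [/\ valring Q, series_ring `<=` Q & series_max `<=` nonunit Q].
Proof. exact: chevalley series_pair. Qed.

End SeriesValuation.

(** * Going down *)

Section FractionField.
Variables (R : idomainType) (F : fieldType) (j : {rmorphism R -> F}).
Hypothesis j_inj : injective j.

Lemma jneq0 r : r != 0 -> j r != 0.
Proof. by rewrite -(inj_eq j_inj) rmorph0. Qed.

Definition frac_field : set F := [set x | exists r s, s != 0 /\ x = j r / j s].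

Lemma frac_field_subring : subring frac_field.
Proof.
split; first by exists 1, 1; rewrite oner_neq0 rmorph1 divr1.
- move=> _ _ [r [s [s0 ->]]] [r' [s' [s'0 ->]]].
  exists (r * s' - r' * s), (s * s'); rewrite mulf_neq0 //; split=> //.
  by rewrite rmorphB !rmorphM; field; rewrite !jneq0.
- move=> _ _ [r [s [s0 ->]]] [r' [s' [s'0 ->]]].
  exists (r * r'), (s * s'); rewrite mulf_neq0 //; split=> //.
  by rewrite !rmorphM invfM mulrACA.
Qed.

Lemma frac_field_inv x : frac_field x -> frac_field x^-1.
Proof.
move=> [r [s [s0 ->]]]; rewrite invf_div.
have [->|r0] := eqVneq r 0; last by exists s, r.
by exists 0, 1; rewrite oner_neq0 !rmorph0 invr0 mulr0 mul0r.
Qed.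

Lemma frac_field_gen r : frac_field (j r).
Proof. by exists r, 1; rewrite oner_neq0 rmorph1 divr1. Qed.

(** A fraction r / s is in R once its powers have a common denominator u. *)
Definition completely_integrally_closed := forall u r s : R, u != 0 -> s != 0 ->
  (forall d, exists q, u * r ^+ d = q * s ^+ d) -> exists q, r = q * s.

Hypothesis R_normal : completely_integrally_closed.

(** The powers of x = r / s have bounded denominators. *)
Lemma integral_frac x : frac_field x -> integralOver j x -> exists q, x = j q.
Proof.
move=> [r [s [s0 xE]]] [p pm px].
pose T : set F := range j.
have rT : subring T.
  split; first by exists 1; rewrite ?rmorph1.
  - by move=> _ _ [u _ <-] [v _ <-]; exists (u - v); rewrite ?rmorphB.
  - by move=> _ _ [u _ <-] [v _ <-]; exists (u * v); rewrite ?rmorphM.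
pose P := map_poly j p; have Pm : P \is monic by exact: monic_map.
have js0 := jneq0 s0.
have [||q rq] := @R_normal (s ^+ size P) r s _ s0 _; first exact: expf_neq0.
  move=> d.
  have [||g [u [Tg gP E]]] := @monic_division _ T P 'X^d rT Pm.
  - by move=> i; rewrite coef_map; exists p`_i.
  - move=> i; rewrite coefXn; have T0 := subring0 rT.
    by case: (_ == _) => //; case: rT.
  have xd : x ^+ d = g.[x].
    have := congr1 (fun h : {poly F} => h.[x]) E.
    by rewrite hornerXn hornerD hornerM (rootP px) mulr0 add0r.
  have /choice[h Hh] : forall i, exists h, g`_i = j h.
    by move=> i; have [h _ <-] := Tg i; exists h.
  exists (\sum_(i < size P) h i * r ^+ i * s ^+ (size P - i)).
  apply: j_inj; rewrite !rmorphM !rmorphXn rmorph_sum /=.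
  have -> : j r ^+ d = x ^+ d * j s ^+ d by rewrite xE -exprMn divfK.
  rewrite mulrA; congr (_ * _); rewrite xd (horner_coef_wide _ (ltnW gP)) mulr_sumr.
  apply: eq_bigr => i _; rewrite Hh !rmorphM !rmorphXn mulrCA mulrAC -mulrA; congr (_ * _).
  have iP : (i <= size P)%N by rewrite ltnW.
  by rewrite -{1}(subnK iP) exprD -mulrA -exprMn xE mulrCA divff // mulr1 mulrC.
by exists q; rewrite xE rq rmorphM mulfK.
Qed.

(** The minimal polynomial over the fraction field of R of an integral element
    has coefficients in R: by Gauss's lemma they are in every valuation ring
    above R, so they are integral over R, and R is normal. *)
Lemma minimal_polynomial w : integralOver j w ->
  exists g : {poly F}, [/\ g \is monic, root g w,
    forall i, exists q, g`_i = j q &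
    forall G : {poly F}, coefs_in frac_field G -> root G w -> exists u, G = u * g].
Proof.
move=> [p pm pw].
have rE := frac_field_subring.
pose isg n := exists g : {poly F},
  [/\ size g = n, g \is monic, root g w & coefs_in frac_field g].
have [|n [g [sg gm gw Eg]] min] := @least_nat isg.
  exists (size (map_poly j p)), (map_poly j p); split=> //; first exact: monic_map.
  by move=> i; rewrite coef_map; exact: frac_field_gen.
have div (G : {poly F}) : coefs_in frac_field G -> root G w -> exists u, G = u * g.
  move=> EG Gw; have [r [u [Er rg E]]] := monic_division rE gm Eg EG.
  exists u; rewrite E; have [->|r0] := eqVneq r 0; first by rewrite addr0.
  exfalso; apply: (min (size r)); first by rewrite -sg.
  exists ((lead_coef r)^-1 *: r); split.
  - by rewrite -mul_polyC size_Cmul // invr_eq0 lead_coef_eq0.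
  - by rewrite monicE lead_coefZ mulVf // lead_coef_eq0.
  - move: Gw; rewrite !rootE E hornerD hornerM (rootP gw) mulr0 add0r hornerZ => /eqP->.
    by rewrite mulr0.
  - move=> i; rewrite coefZ; apply: subringM => //; apply: frac_field_inv.
    by rewrite lead_coefE.
exists g; split=> // i; apply: integral_frac => //; apply: valring_integral => O vO Oj.
have [|u pE] := div (map_poly j p) _ pw.
  by move=> l; rewrite coef_map; exact: frac_field_gen.
have Pm : map_poly j p \is monic by exact: monic_map.
have um : u \is monic by move: Pm; rewrite pE monicMr.
apply: (gauss_monic vO gm um); rewrite mulrC -pE => l.
by rewrite coef_map /=.
Qed.

End FractionField.

Section Extension.
Variables (R : idomainType) (F k : fieldType) (j : {rmorphism R -> F}).
Hypothesis j_inj : injective j.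
Variable c : R -> nat -> k.
Hypothesis cB : forall r s i, c (r - s) i = c r i - c s i.
Hypothesis cM : forall r s i, c (r * s) i = \sum_(l < i.+1) c r l * c s (i - l).
Hypothesis c_neq0 : forall r, r != 0 -> exists i, c r i != 0.
Hypothesis R_normal : completely_integrally_closed R.
Variable O : set F.
Hypothesis vO : valring O.
Hypothesis Oj : forall r, O (j r).
Hypothesis O_center : forall r, nonunit O (j r) <-> c r 0 = 0.

Local Notation W := (series_ring j c).
Local Notation M := (series_max j c).

(** A form of going down: the valuation ring W of the fraction field of R has an
    extension Q at which w is a unit, if w is a unit at a valuation ring O with
    the same center on R as W. Otherwise w would satisfy a monic equation over W
    whose lower coefficients are in M. Then the lower coefficients of its
    minimal polynomial, which are in R, would be in the center as well, and w
    would not be a unit at O. *)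
Lemma going_down w : integralOver j w -> ~ nonunit O w ->
  exists Q, [/\ valring Q, W `<=` Q, M `<=` nonunit Q & Q w^-1].
Proof.
move=> wi wO.
have w0 : w != 0 by apply/eqP => w0; apply: wO; left.
have rW := series_subring j_inj cB cM c_neq0.
have iM := series_ideal j_inj cB cM c_neq0.
have [[p Mp p1]|M1] := pselect (adjoin M w^-1 1); last first.
  have [] := @chevalley _ (adjoin W w^-1) (adjoin M w^-1).
    by split=> //; [exact: adjoin_subring|exact: adjoin_ideal].
  move=> Q [vQ WQ MQ]; exists Q; split=> //.
  - by apply: subset_trans WQ; apply: sub_adjoin; exact: subring0.
  - by apply: subset_trans MQ; apply: sub_adjoin; case: iM.
  - by apply: WQ; exact: adjoin_gen.
exfalso.
have [g [gm gw gj gdiv]] := minimal_polynomial j_inj R_normal wi.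
have M0 : M 0 by case: iM.
have WE : W `<=` frac_field j.
  by move=> _ [r [s [m [/(ord_eq_neq0 cB) s0 _ ->]]]]; exists r, s.
pose n := size p.
have Nu : ~ M (1 - p`_0).
  move=> Mu; apply: (series_max_neq1 j_inj cB (c := c)).
  by rewrite -(subrK p`_0 1); case: iM => _ _ + _; apply.
have Wu : W (1 - p`_0)^-1.
  apply: series_ring_inv => //; case: (rW) => W1 WB _; apply: WB => //.
  exact: series_max_sub.
have u0 : 1 - p`_0 != 0 by apply: contra_not_neq Nu => ->.
pose G : {poly F} := (1 - p`_0)^-1 *: ('X^n - \poly_(i < n.+1) p`_(n - i)).
have GE i : G`_i = if (i < n)%N then - ((1 - p`_0)^-1 * p`_(n - i)) else (i == n)%:R.
  rewrite coefZ coefB coefXn coef_poly ltnS leq_eqVlt.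
  have [->|ni] := eqVneq i n; first by rewrite ltnn subnn mulVf.
  by rewrite /=; case: ifP => _; rewrite ?subr0 ?mulr0 // sub0r mulrN.
have sG : size G = n.+1.
  apply/eqP; rewrite eqn_leq; apply/andP; split.
    apply/leq_sizeP => i ni; rewrite GE ltnNge (ltnW ni) /=.
    by rewrite gtn_eqF.
  rewrite ltnNge; apply/negP => /leq_sizeP/(_ n (leqnn n))/eqP.
  by rewrite GE ltnn eqxx oner_eq0.
have Gm : G \is monic by rewrite monicE lead_coefE sG GE ltnn eqxx.
have Gw : root G w.
  rewrite rootE hornerZ hornerD hornerN hornerXn horner_poly -rev_horner //.
  by rewrite -p1 mulr1 subrr mulr0.
have MG i : (i < n)%N -> M G`_i.
  move=> ni; rewrite GE ni; apply: (idealN rW iM).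
  by case: iM => _ _ _; apply.
have WG i : W G`_i.
  have [ni|ni] := ltnP i n; first by apply: series_max_sub; exact: MG.
  rewrite GE ltnNge ni /=; have W0 := subring0 rW.
  by case: (_ == _) => //; case: rW.
have [u Gu] := gdiv G (fun i => WE _ (WG i)) Gw.
have um : u \is monic by move: Gm; rewrite Gu monicMr.
have [Q [vQ WQ MQ]] := dominating_exists j_inj cB cM c_neq0.
have glow i : (i < (size g).-1)%N -> nonunit O g`_i.
  move=> ig; have : nonunit Q g`_i.
    apply: (gauss_monic_low vQ gm um) => // l; rewrite mulrC -Gu sG => ln.
    by apply: MQ; exact: MG.
  have [q ->] := gj i.
  by rewrite (dominating_gen_nonunit j_inj cB cM c_neq0 WQ MQ) => /O_center.
have Ow : O w by exact: integral_valring wi.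
apply: wO; apply: (@nonunitX _ _ vO w (size g).-1).
have sg : (size g) = (size g).-1.+1 by rewrite prednK // size_poly_gt0 monic_neq0.
have := rootP gw; rewrite horner_coef sg big_ord_recr /= -lead_coefE (monicP gm) mul1r.
move/eqP; rewrite addrC addr_eq0 => /eqP ->; apply: nonunitN => //.
apply: (ideal_sum (nonunit_ideal vO)) => i _; rewrite mulrC; apply: nonunitM => //.
  by apply: subringX => //; case: vO.
exact: glow.
Qed.

(** An extension Q of the center need not contain b in its maximal ideal, since
    conjugates of b may be units there. Modulo the center, b is a root of
    X ^ e * h(X) with h(0) a unit; so h(b) is a unit at O, and b is in the
    maximal ideal of every Q at which h(b) is a unit. *)
Lemma separating_element b : integralOver j b -> nonunit O b ->
  exists w, [/\ integralOver j w, ~ nonunit O w &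
    forall Q, valring Q -> (forall r, Q (j r)) ->
      (forall r, c r 0 = 0 -> nonunit Q (j r)) -> Q w^-1 -> nonunit Q b].
Proof.
move=> bi bO; have [H Hm Hb] := bi.
have c10 : c 1 0 != 0.
  have N1 := nonunitN1 vO.
  by apply/eqP => /O_center; rewrite rmorph1.
have [|e ce mine] := @least_nat (fun i => c H`_i 0 != 0).
  by exists (size H).-1; rewrite -lead_coefE (monicP Hm).
pose h := map_poly j (drop_poly e H).
have h0 : h`_0 = j H`_e by rewrite coef_map coef_drop_poly.
have hD : h = drop_poly 1 h * 'X + (h`_0)%:P.
  apply/polyP => i; move: h {h0} => h; rewrite coefD coefMX coefC coef_drop_poly.
  by case: i => [|i] /=; rewrite ?add0r // addr0 addn1.
have hi l : exists r, h`_l = j r by rewrite coef_map; eexists.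
have hO (A : set F) : subring A -> (forall r, A (j r)) -> A b -> A h.[b].
  by move=> rA Aj Ab; apply: subring_horner => // l; have [r ->] := hi l.
have Nw : ~ nonunit O h.[b].
  rewrite hD hornerD hornerM hornerX hornerC h0 => Nh.
  have : nonunit O (j H`_e).
    set y := _ * b in Nh; rewrite -(addKr y (j _)) addrC; apply: nonunitB => //.
    apply: nonunitM => //; apply: subring_horner; [by case: vO| |exact: nonunit_sub].
    by move=> l; rewrite coef_drop_poly; have [r ->] := hi (l + 1)%N.
  by move=> /O_center/eqP; apply/negP.
exists h.[b]; split=> //.
- apply: integral_horner => //; apply/integral_poly => l.
  by have [r ->] := hi l; exact: integral_id.
move=> Q vQ Qj Qc Qw; have rQ : subring Q by case: vQ.
have Qb : Q b by exact: integral_valring bi.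
have Qt : nonunit Q (h.[b] * b ^+ e).
  have := rootP Hb; rewrite -{1}(poly_take_drop e H) rmorphD rmorphM /= map_polyXn.
  rewrite hornerD hornerM hornerXn => /eqP; rewrite addrC addr_eq0 => /eqP ->.
  apply: nonunitN => //; apply: (ideal_horner rQ (nonunit_ideal vQ)) => // l.
  rewrite coef_map /= coef_take_poly.
  case: ifP => [/mine/negP|_]; last by rewrite rmorph0; left.
  by rewrite negbK => /eqP/Qc.
apply: (@nonunitX _ _ vQ b e).
have hb0 : h.[b] != 0 by apply/eqP => hb0; apply: Nw; left.
by rewrite -(mulKf hb0 (b ^+ e)); exact: nonunitM.
Qed.

End Extension.

(** * Discreteness of the dominating valuation rings *)

Section Discrete.
Variables (R : idomainType) (F k : fieldType) (j : {rmorphism R -> F}).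
Hypothesis j_inj : injective j.
Variable c : R -> nat -> k.
Hypothesis cB : forall r s i, c (r - s) i = c r i - c s i.
Hypothesis cM : forall r s i, c (r * s) i = \sum_(l < i.+1) c r l * c s (i - l).
Hypothesis c_neq0 : forall r, r != 0 -> exists i, c r i != 0.
Variables (I : finType) (b : I -> F).
Hypothesis F_fin : forall x, fractions j (lin_span j b) x.
Variable Q : set F.
Hypothesis vQ : valring Q.
Hypothesis WQ : series_ring j c `<=` Q.
Hypothesis MQ : series_max j c `<=` nonunit Q.

Let rQ : subring Q. Proof. by case: vQ. Qed.
Let Q1 : Q 1. Proof. by case: rQ. Qed.

Definition is_unit z := Q z /\ Q z^-1.

Lemma is_unitM z t : is_unit z -> is_unit t -> is_unit (z * t).
Proof. by move=> [z1 z2] [t1 t2]; split; rewrite ?invfM; exact: subringM. Qed.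

Lemma is_unitV z : is_unit z -> is_unit z^-1.
Proof. by move=> [z1 z2]; split; rewrite ?invrK. Qed.

Lemma is_unitX z n : is_unit z -> is_unit (z ^+ n).
Proof. by move=> [z1 z2]; split; rewrite -?exprVn; exact: subringX. Qed.

(** In a linear relation between the powers of x two terms have the same dominant
    value, since a single dominant term could not be cancelled. *)
Lemma power_value x : x != 0 -> exists d r s,
  [/\ (0 < d <= #|I|)%N, r != 0, s != 0 & is_unit (x ^+ d * (j r / j s))].
Proof.
move=> x0.
have [|a [i1 a1] Ha] := @lin_span_dependent _ _ j I b (fun i => x ^+ i).
  by move=> i; exact: F_fin.
pose P := \poly_(i < #|I|.+1) (j (a (inord i)) * x ^+ i).
have Pi1 : P`_i1 != 0.
  by rewrite coef_poly ltn_ord inord_val mulf_neq0 ?expf_neq0 ?jneq0.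
have [|i' Pi' dom] := dominant_coef vQ (p := P).
  by apply: contraNneq Pi1 => ->; rewrite coef0.
have P1 : \sum_(i < #|I|.+1) P`_i = 0.
  by rewrite -[RHS]Ha; apply: eq_bigr => i _; rewrite coef_poly ltn_ord inord_val.
have small i : P`_i != 0 -> (i < #|I|.+1)%N /\ a (inord i) != 0.
  rewrite coef_poly; case: ifP => [_|]; last by rewrite eqxx.
  rewrite mulf_eq0 negb_or => /andP[ja _]; split=> //.
  by apply: contraNneq ja => ->; rewrite rmorph0.
have [i'N ai'] := small _ Pi'.
have [[i ii' Ni]|H] :=
  pselect (exists2 i, i != i' & ~ nonunit Q (P`_i / P`_i')); last first.
  exfalso; apply: (nonunitN1 vQ).
  have := congr1 ( *%R^~ (P`_i')^-1) P1.
  rewrite mul0r (bigD1 (Ordinal i'N)) //= mulrDl mulfV // => /eqP.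
  rewrite addr_eq0 => /eqP ->; apply: nonunitN => //; rewrite mulr_suml.
  apply: (ideal_sum (nonunit_ideal vQ)) => i ii'; apply: contrapT => Ni.
  by apply: H; exists (i : nat).
have Pi : P`_i != 0 by apply: contra_not_neq Ni => ->; left; rewrite mul0r.
have [iN ai] := small _ Pi.
have U : is_unit (P`_i / P`_i') by split; [exact: dom|exact: unit_inv].
have PE l : (l < #|I|.+1)%N -> P`_l = j (a (inord l)) * x ^+ l.
  by move=> lN; rewrite coef_poly lN.
have main l l' : (l < #|I|.+1)%N -> (l' < #|I|.+1)%N -> (l' < l)%N ->
    a (inord l) != 0 -> a (inord l') != 0 -> is_unit (P`_l / P`_l') -> exists d r s,
    [/\ (0 < d <= #|I|)%N, r != 0, s != 0 & is_unit (x ^+ d * (j r / j s))].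
  move=> lN l'N ll al al' U'; exists (l - l')%N, (a (inord l)), (a (inord l')).
  split=> //; first by lia.
  suff -> : x ^+ (l - l') * (j (a (inord l)) / j (a (inord l'))) = P`_l / P`_l' by [].
  have E : x ^+ l = x ^+ (l - l') * x ^+ l' by rewrite -exprD subnK // ltnW.
  rewrite !PE // E.
  by field; rewrite jneq0 //= expf_neq0.
have [lt|gt|E] := ltngtP i i'; last by rewrite E eqxx in ii'.
  by apply: (main i' i) => //; rewrite -invf_div; exact: is_unitV.
exact: (main i i').
Qed.

(** The exponent #|I|! kills the value group of Q modulo that of its trace on
    the fraction field of R, by [power_value]; so v is the value of
    x ^+ (#|I|)`! in terms of orders of power series. *)
Definition has_value x (v : int) := exists r s m l,
  [/\ ord_eq c r m, ord_eq c s l, is_unit (x ^+ ((#|I|)`!) * (j r / j s))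
    & v = l%:Z - m%:Z].

Lemma has_value_exists x : x != 0 -> exists v, has_value x v.
Proof.
move=> /power_value[d [r [s [/andP[d0 dI] r0 s0 U]]]].
pose e := ((#|I|)`! %/ d)%N.
have [m rm] := ord_eq_exists c_neq0 (expf_neq0 e r0).
have [l sl] := ord_eq_exists c_neq0 (expf_neq0 e s0).
exists (l%:Z - m%:Z), (r ^+ e), (s ^+ e), m, l; split=> //.
have <- : (d * e)%N = (#|I|)`! by rewrite mulnC divnK // dvdn_fact // d0.
by rewrite !rmorphXn -expr_div_n exprM -exprMn; exact: is_unitX.
Qed.

Lemma has_valueM x y v w : has_value x v -> has_value y w -> has_value (x * y) (v + w).
Proof.
move=> [r [s [m [l [rm sl U ->]]]]] [r' [s' [m' [l' [rm' sl' U' ->]]]]].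
exists (r * r'), (s * s'), (m + m')%N, (l + l')%N; split; try exact: ord_eqM.
  have := is_unitM U U'; congr is_unit.
  by rewrite exprMn !rmorphM invfM; ring.
by rewrite !PoszD; ring.
Qed.

Lemma has_valueV x v : has_value x v -> has_value x^-1 (- v).
Proof.
move=> [r [s [m [l [rm sl U ->]]]]]; exists s, r, l, m; split=> //; last by ring.
by have := is_unitV U; rewrite invfM exprVn invf_div.
Qed.

Lemma has_value_ge0 x v : x != 0 -> has_value x v -> (Q x <-> 0 <= v).
Proof.
move=> x0 [r [s [m [l [rm sl U ->]]]]]; rewrite subr_ge0 lez_nat.
rewrite -(dominating_frac j_inj cB WQ MQ sl rm).
have e0 := fact_gt0 #|I|.
have jr0 := ord_eq_image_neq0 j_inj cB rm; have js0 := ord_eq_image_neq0 j_inj cB sl.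
set z := x ^+ _ * _ in U.
have xE : x ^+ ((#|I|)`!) = z * (j s / j r) by rewrite /z; field; rewrite jr0 js0.
have sE : j s / j r = z^-1 * x ^+ ((#|I|)`!).
  by rewrite /z; field; rewrite jr0 js0 expf_neq0.
split=> [Qx|Qsr].
  by rewrite sE; apply: subringM => //; [case: U|exact: subringX].
apply: contrapT => /(valringVN (F := F)) Nx.
have Qx : Q (x ^+ ((#|I|)`!)) by rewrite xE; apply: subringM => //; case: U.
have : nonunit Q (x^-1 ^+ ((#|I|)`!)).
  rewrite -(prednK e0) exprSr; apply: nonunitM => //.
  by apply: subringX => //; exact: nonunit_sub.
move=> /nonunit_inv; rewrite exprVn invrK => /(_ Qx)/eqP.
by rewrite invr_eq0 expf_eq0 (negPf x0) andbF.
Qed.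

Lemma has_value_uniq x v w : x != 0 -> has_value x v -> has_value x w -> v = w.
Proof.
move=> x0 xv xw.
have H a d : has_value x a -> has_value x d -> 0 <= a - d.
  move=> xa xd; apply/(has_value_ge0 (oner_neq0 F)) => //.
  by rewrite -(divff x0); apply: has_valueM => //; exact: has_valueV.
by apply/le_anti/andP; split; rewrite -subr_ge0; exact: H.
Qed.

(** The values form a nonzero subgroup of int; division by its positive
    generator g normalizes the valuation. *)
Lemma discrete_dominating : (exists x, ~ Q x) -> exists v : F -> int,
  [/\ forall x y, x != 0 -> y != 0 -> v (x * y) = v x + v y,
      forall n, exists2 x, x != 0 & v x = n &
      forall x, x != 0 -> (Q x <-> 0 <= v x)].
Proof.
move=> [x1 Qx1].
have x10 : x1 != 0 by apply/eqP => x10; apply: Qx1; rewrite x10; exact: subring0.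
have ex x : exists v, x != 0 -> has_value x v.
  have [->|x0] := eqVneq x 0; first by exists 0.
  by have [v xv] := has_value_exists x0; exists v.
have [V HV] := choice ex.
have VM x y : x != 0 -> y != 0 -> V (x * y) = V x + V y.
  move=> x0 y0; apply: (@has_value_uniq (x * y)); first exact: mulf_neq0.
    by apply: HV; exact: mulf_neq0.
  by apply: has_valueM; exact: HV.
have VV x : x != 0 -> V x^-1 = - V x.
  move=> x0; apply: (@has_value_uniq x^-1); first by rewrite invr_eq0.
    by apply: HV; rewrite invr_eq0.
  by apply: has_valueV; exact: HV.
have V1 : V 1 = 0.
  by have := VM 1 1 (oner_neq0 _) (oner_neq0 _); rewrite mulr1; lia.
have Vge0 x : x != 0 -> (Q x <-> 0 <= V x).
  by move=> x0; apply: has_value_ge0 => //; exact: HV.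
have [|g [g0 [t [t0 Vt]]] ming] :=
  @least_nat (fun n => (0 < n)%N /\ exists t, t != 0 /\ V t = n%:Z).
  have V0 : V x1 < 0 by rewrite ltNge; apply/negP => /(Vge0 _ x10).
  exists `|V x1|%N; split; first by lia.
  by exists x1^-1; rewrite invr_eq0; split=> //; rewrite VV //; lia.
have pow (n : int) : exists2 y, y != 0 & V y = n * g%:Z.
  have pown (d : nat) : exists2 y, y != 0 & V y = d%:Z * g%:Z.
    elim: d => [|d [y y0 Vy]]; first by exists 1; rewrite ?oner_neq0 ?mul0r.
    exists (t * y); first exact: mulf_neq0.
    by rewrite VM // Vy Vt; lia.
  case: n => d; first exact: pown.
  have [y y0 Vy] := pown d.+1; exists y^-1; first by rewrite invr_eq0.
  by rewrite VV // Vy NegzE mulNr.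
have dvd x : x != 0 -> V x = (V x %/ g)%Z * g.
  move=> x0; have [y y0 Vy] := pow (- (V x %/ g)%Z).
  have g0' : g%:Z != 0 by lia.
  have := divz_eq (V x) g; set q := (V x %/ g)%Z in Vy *.
  have := modz_ge0 (V x) g0'; have := ltz_mod (V x) g0'.
  set m := (V x %% g)%Z => mg m0 E.
  have Vm : V (x * y) = m by rewrite VM // Vy E; lia.
  have [m00|m00] := eqVneq m 0; first by rewrite {1}E m00 addr0.
  exfalso; apply: (ming `|m|%N); first by lia.
  by split; [lia|exists (x * y); rewrite mulf_neq0 //; split=> //; lia].
have g0' : g%:Z != 0 by lia.
exists (fun x => (V x %/ g)%Z); split=> [x y x0 y0|n|x x0].
- apply: (mulIf g0'); rewrite mulrDl -!dvd //; last exact: mulf_neq0.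
  exact: VM.
- by have [y y0 Vy] := pow n; exists y => //; rewrite Vy mulzK.
- rewrite Vge0 // {1}dvd // pmulr_lge0 //; lia.
Qed.

End Discrete.

(** * Finiteness of the residue field *)

(** A longest independent family of elements of V spans V. *)
Lemma spanning_family (L : fieldType) (S V : set L) N : subring S ->
    (forall x, S x -> S x^-1) ->
    (forall x : 'I_N.+1 -> L, (forall i, V (x i)) -> exists c,
      [/\ forall i, S (c i), exists i, c i != 0 & \sum_i c i * x i = 0]) ->
  exists n (z : 'I_n -> L), forall x, V x -> exists c : 'I_n -> L,
    (forall i, S (c i)) /\ x = \sum_i c i * z i.
Proof.
move=> rS SV; elim: N => [|N IH] dep.
  exists 0%N, (fun=> 0) => x Vx; exists (fun=> 0); split; first by case.
  have [//|c [_ [i ci]]] := dep (fun=> x).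
  rewrite big_ord1 big_ord0 (ord1 i) in ci * => /eqP.
  by rewrite mulf_eq0 (negPf ci) => /eqP.
have [/IH//|/existsNP[z /not_implyP[Vz Nz]]] := pselect (forall x : 'I_N.+1 -> L,
  (forall i, V (x i)) -> exists c,
    [/\ forall i, S (c i), exists i, c i != 0 & \sum_i c i * x i = 0]).
exists N.+1, z => x Vx.
have [|c [Sc [i0 ci0] E]] := dep (fun i => if unlift ord0 i is Some i' then z i' else x).
  by move=> i; case: unlift.
move: E; rewrite big_ord_recl unlift_none.
rewrite (eq_bigr (fun i => c (lift ord0 i) * z i)); last by move=> i _; rewrite liftK.
have [c0|c0] := eqVneq (c ord0) 0.
  rewrite c0 mul0r add0r => E; exfalso; apply: Nz; exists (fun i => c (lift ord0 i)).
  split=> //; move: ci0; case: (unliftP ord0 i0) => [i ->|->]; first by exists i.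
  by rewrite c0 eqxx.
move=> /eqP; rewrite addr_eq0 => /eqP E.
exists (fun i => - (c ord0)^-1 * c (lift ord0 i)); split.
  by move=> i; apply: subringM => //; apply: subringN => //; exact: SV.
apply: (mulfI c0); rewrite E mulr_sumr -sumrN; apply: eq_bigr => i _.
by field.
Qed.

Lemma finite_extension_algebraic (K E : fieldType) (f : {rmorphism K -> E}) :
  finite_extension f -> forall x, algebraicOver f x.
Proof.
move=> [n [e He]] x.
have [M HM] := choice (fun i : 'I_n.+1 => He (x ^+ i)).
have [c [i0 ci0] Hc] := nontrivial_relation M.
exists (\poly_(i < n.+1) c (inord i)).
  apply: contraNneq ci0 => /(congr1 (fun p : {poly K} => p`_i0)).
  by rewrite coef_poly ltn_ord inord_val coef0 => ->.
rewrite rootE (@horner_coef_wide _ n.+1); last first.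
  by apply: leq_trans (size_poly _ _); exact: size_poly.
apply/eqP; rewrite (eq_bigr (fun i : 'I_n.+1 => \sum_l f (c i * M i l) * e l)).
  by rewrite exchange_big big1 // => l _; rewrite -mulr_suml -rmorph_sum Hc rmorph0 mul0r.
move=> i _; rewrite coef_map coef_poly ltn_ord inord_val HM mulr_sumr.
by apply: eq_bigr => l _; rewrite rmorphM mulrA.
Qed.

Section Final.
Import mpoly.

Lemma algebraic_dependent (K E : fieldType) (f : {rmorphism K -> E}) (t : 'I_1 -> E) :
  algebraicOver f (t ord0) -> ~ alg_independent f t.
Proof.
move=> [p p0 /rootP pt] indep.
pose q := (map_poly (@mpolyC 1 K) p).['X_ord0].
have q0 : q = 0.
  apply: indep; rewrite /q -horner_map -map_poly_comp /= mmapX mmap1U -pt.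
  by congr horner; apply: eq_map_poly => a /=; rewrite mmapC.
have := congr1 (mmap (@polyC K) (fun=> 'X)) q0.
rewrite rmorph0 /q -horner_map -map_poly_comp /= mmapX mmap1U.
rewrite (eq_map_poly (g := polyC)); last by move=> a /=; rewrite mmapC.
by move=> pX; move/eqP: p0; apply; rewrite -[p]comp_polyXr.
Qed.

Lemma finite_zero_dimensional (K E : fieldType) (f : {rmorphism K -> E}) :
  finite_extension f -> trdeg_eq f 0.
Proof.
move=> fin; split; first by exists (fun=> 0); exact: alg_independent0.
move=> [t]; apply: algebraic_dependent; exact: finite_extension_algebraic.
Qed.

Lemma finite_tower (K E : fieldType) (f : {rmorphism K -> E}) (V : set E) n n'
    (z : 'I_n -> E) (z' : 'I_n' -> E) :
    (forall x, V x -> exists c : 'I_n -> E,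
      (forall i, range f (c i)) /\ x = \sum_i c i * z i) ->
    (forall x, exists c : 'I_n' -> E,
      (forall i, V (c i)) /\ x = \sum_i c i * z' i) ->
  finite_extension f.
Proof.
move=> Hz Hz'; pose T := ('I_n * 'I_n')%type.
exists #|{: T}|, (fun i => z (enum_val i).1 * z' (enum_val i).2) => x.
have [c' [Vc' ->]] := Hz' x.
have [c Hc] := choice (fun i => Hz _ (Vc' i)).
have /choice[d Hd] i : exists d : 'I_n -> K, forall l, c i l = f (d l).
  have [fc _] := Hc i; have /choice[d Hd] l : exists a, c i l = f a.
    by have [a _ <-] := fc l; exists a.
  by exists d.
exists (fun i => d (enum_val i).2 (enum_val i).1).
pose G (a : 'I_n) (b : 'I_n') := f (d b a) * (z a * z' b).
transitivity (\sum_(p : T) G p.1 p.2); last first.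
  by rewrite (reindex (@enum_val _ {: T})) //; exact/onW_bij/enum_val_bij.
rewrite -(pair_bigA _ G) exchange_big /=.
apply: eq_bigr => i _; rewrite (Hc i).2 mulr_suml; apply: eq_bigr => l _.
by rewrite /G Hd mulrA.
Qed.

End Final.

Section ResidueExtension.
Import mpoly.
Variables (K F k : fieldType) (iota : {rmorphism K -> F}) (emb : {rmorphism K -> k}).
Variables (n : nat) (y : 'I_n -> F) (y0 : 'I_n -> k).
Local Notation R := {mpoly K[n]}.
Let j : {rmorphism R -> F} := mmap iota y.
Hypothesis j_inj : injective j.
Let c : R -> nat -> k := arc_coef emb y0.

Let cB : forall r s i, c (r - s) i = c r i - c s i.
Proof. by move=> r s i; exact: arc_coefB. Qed.
Let cM : forall r s i, c (r * s) i = \sum_(l < i.+1) c r l * c s (i - l).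
Proof. by move=> r s i; exact: arc_coefM. Qed.
Let c_neq0 : forall r, r != 0 -> exists i, c r i != 0.
Proof. by move=> r; exact: arc_coef_neq0. Qed.

Variables (I : finType) (b : I -> F).
Hypothesis F_fin : forall x, fractions j (lin_span j b) x.
Variables (I0 : finType) (b0 : I0 -> k).
Hypothesis rT0 : subring (lin_span emb b0).
Hypothesis T0_emb : forall a, lin_span emb b0 (emb a).
Hypothesis T0_y0 : forall i, lin_span emb b0 (y0 i).
Variable P : place iota.
Hypothesis WP : series_ring j c `<=` val_ring P.
Hypothesis MP : series_max j c `<=` nonunit (val_ring P).

Lemma common_denominator N (e : nat -> F) : (forall i, series_ring j c (e i)) ->
  exists s m, ord_eq c s m /\
    forall i, (i < N)%N -> exists2 r, ord_ge c r m & e i = j r / j s.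
Proof.
move=> We; elim: N => [|N [s [m [sm Hs]]]].
  by exists 1, 0%N; split=> //; exact: (ord_eq1 cM c_neq0).
have [r [s' [m' [sm' rm' E]]]] := We N; rewrite addn0 in rm'.
exists (s * s'), (m + m')%N; split; first exact: (ord_eqM cM).
have js0 := ord_eq_image_neq0 j_inj cB sm; have js0' := ord_eq_image_neq0 j_inj cB sm'.
move=> i; rewrite ltnS leq_eqVlt => /predU1P[->|/Hs[r' rm ->]].
  exists (s * r); first by apply: (ord_geM cM) => //; case: sm.
  by rewrite E !rmorphM; field; rewrite js0 js0'.
exists (r' * s'); first by apply: (ord_geM cM) => //; case: sm'.
by rewrite !rmorphM; field; rewrite js0 js0'.
Qed.

Lemma place_sum m (x : 'I_m -> F) (a : 'I_m -> residue P) :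
  (forall i, P (x i) = Some (a i)) -> P (\sum_i x i) = Some (\sum_i a i).
Proof.
move=> H; apply: (big_ind2 (fun u v => P u = Some v)) => //; first exact: place0.
by move=> *; exact: place_add.
Qed.

(** The residue field of the trace of P on the fraction field of R. *)
Definition base_residue : set (residue P) :=
  [set a | exists2 e, series_ring j c e & P e = Some a].

Lemma base_residue_subring : subring base_residue.
Proof.
have rW := series_subring j_inj cB cM c_neq0.
split; first by exists 1; [case: rW|exact: place1].
- move=> u v [e We Pe] [e' We' Pe']; exists (e - e').
    by case: rW => _ WB _; exact: WB.
  by apply: place_add => //; exact: placeN.
- move=> u v [e We Pe] [e' We' Pe']; exists (e * e'); first exact: subringM.
  exact: place_mul.
Qed.

Lemma place_invE x a : P x = Some a -> a != 0 -> P x^-1 = Some a^-1.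
Proof.
move=> Px a0; have x0 : x != 0.
  by apply: contraNneq a0 => x0; move: Px; rewrite x0 place0 => -[<-].
case E : (P x^-1) => [a'|].
  have := place_mul Px E; rewrite divff // place1 => -[aa]; congr Some.
  by apply: (mulfI a0); rewrite -aa divff.
by have := place_inv E; rewrite invrK Px => -[/eqP]; rewrite (negPf a0).
Qed.

Lemma base_residue_inv a : base_residue a -> base_residue a^-1.
Proof.
move=> [e We Pe]; have [->|a0] := eqVneq a 0.
  by rewrite invr0; apply: subring0; exact: base_residue_subring.
exists e^-1; last exact: place_invE.
apply: (series_ring_inv We) => /MP.
by rewrite -max_ideal_nonunit /max_ideal /= Pe => -[/eqP]; rewrite (negPf a0).
Qed.

(** Over a common denominator of order m, the residues of fractions are
    proportional to the coefficients of order m of their numerators, which lie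
    in a finite-dimensional space. *)
Lemma base_residue_finite : exists m (z : 'I_m -> residue P),
  forall x, base_residue x -> exists a : 'I_m -> residue P,
    (forall i, range (residue_emb P) (a i)) /\ x = \sum_i a i * z i.
Proof.
apply: (@spanning_family _ _ _ #|I0|).
- split; first by exists 1; rewrite ?rmorph1.
  + by move=> _ _ [u _ <-] [v _ <-]; exists (u - v); rewrite ?rmorphB.
  + by move=> _ _ [u _ <-] [v _ <-]; exists (u * v); rewrite ?rmorphM.
- by move=> _ [u _ <-]; exists u^-1; rewrite ?fmorphV.
move=> x Vx.
have /choice[e He] i : exists e, series_ring j c e /\ P e = Some (x i).
  by have [e] := Vx i; exists e.
have [s [m [sm Hs]]] := @common_denominator #|I0|.+1 (fun i => e (inord i))
  (fun i => (He _).1).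
have /choice[r Hr] (i : 'I_#|I0|.+1) : exists r, ord_ge c r m /\ e i = j r / j s.
  by have [r rm E] := Hs i (ltn_ord i); exists r; split=> //; rewrite -E inord_val.
have [_ _ TS] := fractions_subfield (fmorph_inj emb) rT0 T0_emb.
have [|d [i0 di0] Hd] := @lin_span_dependent _ _ emb I0 b0 (fun i => c (r i) m).
  by move=> i; apply: TS; exact: arc_coef_in.
exists (fun i => residue_emb P (d i)); split.
- by move=> i; exists (d i).
- by exists i0; rewrite fmorph_eq0.
pose q := \sum_i d i *: r i : R.
have cq l : c q l = \sum_i emb (d i) * c (r i) l.
  rewrite /q; elim/big_ind2: _ => [|u v u' v' E E'|i _]; first exact: (c0 cB).
    by rewrite (cD cB) E E'.
  exact: arc_coefZ.
have Mq : series_max j c (\sum_i iota (d i) * e i).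
  exists q, s, m; split=> //.
    move=> l; rewrite addn1 ltnS leq_eqVlt => /predU1P[->|lm]; first by rewrite cq.
    by rewrite cq big1 // => i _; rewrite (Hr i).1 // mulr0.
  rewrite /q rmorph_sum mulr_suml; apply: eq_bigr => i _.
  by rewrite (Hr i).2 mulrA; congr (_ / _); exact/esym/mmapZ.
have := MP Mq; rewrite -max_ideal_nonunit /max_ideal /=.
rewrite (@place_sum _ _ (fun i => residue_emb P (d i) * x i)) => [[]//|i].
by apply: place_mul; [exact: place_id|exact: (He i).2].
Qed.

(** The residue field of P is finite over [base_residue]: a linear relation
    between lifts, divided by its dominant coefficient, reduces to a nontrivial
    relation between the residues. *)
Lemma residue_finite : finite_extension (residue_emb P).
Proof.
have vP := val_ring_valring P.
have [m [z Hz]] := base_residue_finite.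
have [] := @spanning_family (residue P) base_residue setT #|I|.
- exact: base_residue_subring.
- exact: base_residue_inv.
- move=> x _; have [x' Hx'] := choice (fun i => place_surj (x i)).
  have [|a [i1 ai1] Ha] := @lin_span_dependent _ _ j I b x'.
    by move=> i; exact: F_fin.
  pose p := \poly_(i < #|I|.+1) j (a (inord i)).
  have pE (i : 'I_#|I|.+1) : p`_i = j (a i) by rewrite coef_poly ltn_ord inord_val.
  have [|l pl0 dom] := dominant_coef vP (p := p).
    apply/eqP => p0; move: ai1; rewrite -(inj_eq j_inj) rmorph0 -pE p0 coef0.
    by rewrite eqxx.
  have lI : (l < #|I|.+1)%N.
    by rewrite ltnNge; apply: contra pl0 => Il; rewrite coef_poly ltnNge Il.
  pose i0 := Ordinal lI.
  have ai0 : a i0 != 0.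
    by apply: contraNneq pl0 => E; rewrite (pE i0) E rmorph0.
  have We i : series_ring j c (j (a i) / j (a i0)).
    have [->|ai] := eqVneq (a i) 0.
      rewrite rmorph0 mul0r; apply: subring0.
      exact: (series_subring j_inj cB cM c_neq0).
    have [mi ami] := ord_eq_exists c_neq0 ai.
    have [m0 am0] := ord_eq_exists c_neq0 ai0.
    have := dom i; rewrite pE (pE i0) (dominating_frac j_inj cB WP MP ami am0) => le.
    exists (a i), (a i0), m0; split=> // d; rewrite addn0 => dm.
    by case: ami => + _; apply; exact: leq_trans le.
  have /choice[eb Heb] i : exists u, P (j (a i) / j (a i0)) = Some u.
    exact: place_def (WP (We i)).
  exists eb; split.
  + by move=> i; exists (j (a i) / j (a i0)).
  + exists i0; have := Heb i0; rewrite divff; last by rewrite -(rmorph0 j) (inj_eq j_inj).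
    by rewrite place1 => -[<-]; exact: oner_neq0.
  have : P (\sum_i j (a i) / j (a i0) * x' i) = Some (\sum_i eb i * x i).
    by apply: place_sum => i; exact: place_mul.
  have -> : \sum_i j (a i) / j (a i0) * x' i = 0.
    transitivity (\sum_i (j (a i) * x' i) / j (a i0)).
      by apply: eq_bigr => i _; rewrite mulrAC.
    by rewrite -mulr_suml Ha mul0r.
  by rewrite place0 => -[].
move=> m' [z' Hz']; apply: (finite_tower Hz) => x; exact: Hz'.
Qed.

End ResidueExtension.

(** * Density *)

Section Approximation.
Import mpoly.

(** If the valuation ring were F, then F would be its own residue field, hence
    algebraic over K. *)
Lemma finite_residue_nontrivial (K F : fieldType) (iota : {rmorphism K -> F})
    (P : place iota) :
  trdeg_ge iota 1 -> finite_extension (residue_emb P) -> exists x, ~ val_ring P x.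
Proof.
move=> [t indep] fin; apply: contrapT => /forallNP all.
have Pall x : val_ring P x by apply: contrapT; exact: all.
have [a Pt] := place_def (Pall (t ord0)).
have [p p0 pa] := finite_extension_algebraic fin a.
apply: (algebraic_dependent _ indep); exists p => //.
have : max_ideal P (map_poly iota p).[t ord0].
  rewrite /max_ideal /= -(rootP pa); apply: place_horner => // i.
  by rewrite !coef_map; exact: place_id.
by rewrite max_ideal_nonunit => -[/eqP|H]; rewrite ?rootE //; case: H; exact: Pall.
Qed.

(** Integrality over K[y] puts A into the valuation ring of Q, and the unit w
    puts B into its maximal ideal; discreteness and finiteness hold for every Q
    that dominates the lacunary valuation ring of K(y). *)
Theorem approximation (K F : fieldType) (iota : {rmorphism K -> F})
    (P : place iota) (A B : seq F) : function_field iota ->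
    (forall a, a \in A -> val_ring P a) -> (forall b, b \in B -> max_ideal P b) ->
  exists Q : place iota,
    [/\ forall a, a \in A -> val_ring Q a, forall b, b \in B -> max_ideal Q b,
        discrete_place Q & finite_extension (residue_emb Q)].
Proof.
move=> [[s gen] trd] PA PB.
(* of each generator of F or its inverse, one is in the valuation ring of P *)
pose normalize x := if `[< val_ring P x >] then x else x^-1.
pose L := A ++ B ++ [seq normalize x | x <- s].
have PL x : x \in L -> val_ring P x.
  rewrite !mem_cat => /or3P[/PA//|/PB|/mapP[g _ ->]]; first exact: val_ring_some.
  rewrite /normalize; case: asboolP => // Pg.
  by apply: nonunit_sub (val_ring_valring P) _ _; exact: valringVN.
pose a (i : 'I_(size L)) := L`_i.
have aL x : x \in L -> exists i, x = a i.
  by move=> xL; exists (Ordinal (etrans (index_mem x L) xL)); rewrite /a nth_index.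
have [P' [PP' P'a P'alg]] :=
  algebraic_specialization (fun i => PL (a i) (mem_nth 0 (ltn_ord i))).
have vP' := val_ring_valring P'.
have [n [y [yi yB ay]]] := noether_normalization iota a.
pose j : {rmorphism {mpoly K[n]} -> F} := mmap iota y.
have j_inj : injective j.
  move=> r r' E; apply/eqP; rewrite -subr_eq0; apply/eqP; apply: yi.
  by rewrite rmorphB /=; apply/eqP; rewrite subr_eq0; apply/eqP.
have jC d : j d%:MP = iota d by rewrite /j /= mmapC.
have intL x : x \in L -> integralOver j x by move=> /aL[i ->]; exact: ay.
(* T0 is a finite K-algebra that contains the center y0 of P' on K[y] *)
have [abar Pabar] := choice (fun i => place_def (P'a i)).
have [|I0 [b0 [rT0 T0_emb T0_a]]] := @finite_module _ _ (residue_emb P') (codom abar).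
  by move=> _ /codomP[i ->]; exact: P'alg (Pabar i).
pose T0 := lin_span (residue_emb P') b0.
have /choice[y0 Hy0] i : exists t, P' (y i) = Some t /\ T0 t.
  pose C : set F := [set x | exists t, P' x = Some t /\ T0 t].
  suff : C (y i) by [].
  apply: yB => [|d|l].
  - split; first by exists 1; rewrite place1; split=> //; case: rT0.
    + move=> u v [u' [Pu Tu]] [v' [Pv Tv]]; exists (u' - v'); split.
        by apply: place_add => //; exact: placeN.
      by case: rT0 => _ TB _; exact: TB.
    + move=> u v [u' [Pu Tu]] [v' [Pv Tv]]; exists (u' * v'); split.
        exact: place_mul.
      exact: subringM.
  - by exists (residue_emb P' d); split; [exact: place_id|exact: T0_emb].
  - by exists (abar l); split=> //; apply: T0_a; exact: codom_f.
pose c := arc_coef (residue_emb P') y0.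
have cB : forall (r r' : {mpoly K[n]}) i, c (r - r') i = c r i - c r' i.
  by move=> *; exact: arc_coefB.
have cM : forall (r r' : {mpoly K[n]}) i,
    c (r * r') i = \sum_(l < i.+1) c r l * c r' (i - l)%N.
  by move=> r r' i; exact: arc_coefM.
have c_neq0 : forall r : {mpoly K[n]}, r != 0 -> exists i, c r i != 0.
  by move=> *; exact: arc_coef_neq0.
have P'j r : P' (j r) = Some (c r 0%N).
  by rewrite /c arc_coef0; apply: place_mmap => i; case: (Hy0 i).
have P'jO r : val_ring P' (j r) by exact: val_ring_some (P'j r).
have center r : nonunit (val_ring P') (j r) <-> c r 0%N = 0.
  by rewrite -max_ideal_nonunit /max_ideal /= P'j; split=> [[]|->].
have normal : completely_integrally_closed {mpoly K[n]}.
  by move=> u r r'; exact: mpoly_almost_integral.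
have [w [wi wP' wB]] : exists w, [/\ integralOver j w, ~ nonunit (val_ring P') w &
    forall Q, valring Q -> (forall r, Q (j r)) ->
      (forall r, c r 0%N = 0 -> nonunit Q (j r)) -> Q w^-1 ->
      forall b, b \in B -> nonunit Q b].
  have BL b : b \in B -> b \in L by rewrite !mem_cat => ->; rewrite orbT.
  have {PB} : forall b, b \in B -> integralOver j b /\ nonunit (val_ring P') b.
    move=> b bB; split; first by apply: intL; exact: BL.
    by rewrite -max_ideal_nonunit; apply: PP'; exact: PB.
  elim: (B) => [|b B' IH] HB.
    by exists 1; split=> //; [exact: integral1|exact: nonunitN1].
  have [|w [wi wP' wB]] := IH; first by move=> b' bB; apply: HB; rewrite inE bB orbT.
  have [bi bP'] := HB b (mem_head _ _).
  have [w' [wi' wP'' wb]] := separating_element vP' P'jO center bi bP'.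
  exists (w' * w); split; first exact: integral_mul.
    by move=> /(nonunit_prime vP'); move/(_ wP'').
  move=> Q vQ Qj Qc Qw.
  have w0 : w != 0 by apply/eqP => w0; apply: wP'; left.
  have w0' : w' != 0 by apply/eqP => w0'; apply: wP''; left.
  have rQ : subring Q by case: vQ.
  have Qw1 : Q w^-1.
    have -> : w^-1 = w' * (w' * w)^-1 by field; rewrite w0 w0'.
    by apply: subringM => //; exact: integral_valring wi'.
  have Qw2 : Q w'^-1.
    have -> : w'^-1 = w * (w' * w)^-1 by field; rewrite w0 w0'.
    by apply: subringM => //; exact: integral_valring wi.
  by move=> b'; rewrite inE => /predU1P[->|]; [exact: wb|exact: wB].
have [Q [vQ WQ MQ Qw]] := going_down j_inj cB cM c_neq0 normal vP' P'jO center wi wP'.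
have Qj r : Q (j r) by exact: (dominating_gen cM c_neq0 WQ).
have [PQ PQE] : exists PQ : place iota, val_ring PQ = Q.
  by apply: exists_place => // d; rewrite -jC.
have [I [b [rT Tj TL]]] := finite_module intL.
have F_fin x : fractions j (lin_span j b) x.
  have [rS SV TS] := fractions_subfield j_inj rT Tj.
  pose S : {pred F} := fun x => `[< fractions j (lin_span j b) x >].
  suff : x \in S by move/asboolP.
  apply: gen => [|d|g gs].
  - split; first by apply/asboolP; case: rS.
    + by move=> u v /asboolP Su /asboolP Sv; apply/asboolP; case: rS => _ SB _; exact: SB.
    + move=> u v /asboolP Su /asboolP Sv; apply/asboolP; apply: subringM => //.
      exact: SV.
  - by apply/asboolP; apply: TS; rewrite -jC.
  - have : lin_span j b (normalize g).
      by apply: TL; rewrite !mem_cat map_f ?orbT.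
    rewrite /normalize; case: asboolP => _ Tg; apply/asboolP; first exact: TS.
    by rewrite -[g]invrK; apply: SV; exact: TS.
have fin : finite_extension (residue_emb PQ).
  apply: (residue_finite j_inj F_fin rT0 T0_emb (fun i => (Hy0 i).2)); rewrite PQE.
    exact: WQ.
  exact: MQ.
exists PQ; split=> //.
- move=> x xA; rewrite PQE; apply: integral_valring (intL x _) => //.
  by rewrite mem_cat xA.
- move=> x xB; rewrite max_ideal_nonunit PQE; apply: wB => // r r0.
  by apply: MQ; exact: series_max_gen.
have := discrete_dominating j_inj cB cM c_neq0 F_fin vQ WQ MQ.
rewrite -PQE => /(_ (finite_residue_nontrivial trd fin))[v Hv].
by exists v.
Qed.

End Approximation.

Theorem corollary10 (K F : fieldType) (iota : {rmorphism K -> F})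
  (hF : function_field iota) :
  dense [set p : place_space iota | exists P : place iota,
    [/\ class_of P = p, discrete_place P, zero_dimensional_place P
      & finite_extension (residue_emb P)]].
Proof.
move=> U [p Up] [D _ UE].
have [ab Dab pab] : exists2 ab, D ab & patch_basic ab p.
  by move: Up; rewrite -UE => -[ab]; exists ab.
have [P Pp] := class_of_surj p.
have [PA PB] : (forall a, a \in ab.1 -> val_ring P a) /\
    (forall b, b \in ab.2 -> max_ideal P b).
  by apply/patch_basic_class; rewrite Pp.
have [Q [QA QB Qd Qf]] := approximation hF PA PB.
exists (class_of Q); split; last first.
  by exists Q; split=> //; exact: finite_zero_dimensional.
by rewrite -UE; exists ab => //; apply/patch_basic_class.
Qed.
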